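(* Let $1\le k\le n$. For every $c\in[n]$ and every subset $A\subseteq[n]\setminus\{c\}$ of size $k-1$, put $\bar A=[n]\setminus(A\cup\{c\})$, let $B_A$ be an arbitrary basis of the coinvariant algebra of $S_{k-1}$ acting on $\mathbf{Q}[\bar x_A]$, let $C_{\bar A}$ be an arbitrary basis of the coinvariant algebra of $S_{n-k}$ acting on $\mathbf{Q}[\bar y_{\bar A}]$ (basis elements being represented by polynomials in $\mathbf{Q}[\bar x_A]$ and $\mathbf{Q}[\bar y_{\bar A}]$ respectively), and let $$m_{(A,c,\bar A)}=\prod_{i\in A,\ i>c}x_i\ \prod_{j\in\bar A,\ j<c}y_j .$$ Then the set $$\bigcup_{A,c}\ \{\,m_{(A,c,\bar A)}\,b\,b' : b\in B_A,\ b'\in C_{\bar A}\,\}$$ (union over all such pairs $(A,c)$) forms a basis of $\mathbf{H}'_{(1^{k-1},n-k+1)}$.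
   Context: $[n]=\{1,\dots,n\}$ and $\mathbf{Q}[\bar x,\bar y]=\mathbf{Q}[x_1,\dots,x_n,y_1,\dots,y_n]$. For $A\subseteq[n]$, $\bar x_A$ denotes the variables $x_i$ ($i\in A$) and $\bar y_A$ the variables $y_i$ ($i\in A$). The coinvariant algebra of the symmetric group permuting the variables of $\mathbf{Q}[\bar x_A]$ is $\mathbf{Q}[\bar x_A]/\langle\Lambda[\bar x_A]^+\rangle$, the quotient by the ideal generated by symmetric polynomials without constant term; similarly for $\mathbf{Q}[\bar y_{\bar A}]$. For the hook shape $\mu=(1^{k-1},n-k+1)$ let $\Delta_\mu$ be the determinant of the $n\times n$ matrix whose $i$-th row is $(1,y_i,\dots,y_i^{n-k},x_i,\dots,x_i^{k-1})$. Let $\mathbf{H}_\mu$ be the $\mathbf{Q}$-span of all partial derivatives (of all orders, including order $0$) of $\Delta_\mu$. Let $\langle f,g\rangle$ be the constant term of $f(\partial_{x_1},\dots,\partial_{x_n};\partial_{y_1},\dots,\partial_{y_n})\,g(\bar x;\bar y)$, let $J_\mu=\mathbf{H}_\mu^\perp$ with respect to $\langle\ ,\ \rangle$ in $\mathbf{Q}[\bar x,\bar y]$ (an ideal), and let $\mathbf{H}'_\mu=\mathbf{Q}[\bar x,\bar y]/J_\mu$. A set of polynomials is said to form a basis of $\mathbf{H}'_\mu$ if its image does. *)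

(* Defs.v *)
From mathcomp Require Import all_boot all_order all_algebra all_fingroup.
From mathcomp Require Import mpoly.

Set Implicit Arguments.
Unset Strict Implicit.
Unset Printing Implicit Defensive.

Import GRing.Theory.
Local Open Scope ring_scope.

Section LinearAlgebra.
Variables (R : fieldType) (V : lmodType R).
Implicit Types (U W S : V -> Prop) (v : V).

Definition lin_span S v : Prop :=
  exists s : seq (R * V),
    (forall t, t \in s -> S t.2) /\ v = \sum_(t <- s) t.1 *: t.2.

Definition spanning_mod U W S : Prop :=
  forall v, U v -> exists w, lin_span S w /\ W (v - w).

Definition independent_mod W S : Prop :=
  forall (s : seq V) (a : V -> R), uniq s -> (forall v, v \in s -> S v) ->
    W (\sum_(v <- s) a v *: v) -> forall v, v \in s -> a v = 0.

(* [S] is a set of representatives in [U] of a basis of the quotient space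
   [U / W], where [W] is a subspace of [U]: distinct elements of [S] have
   distinct classes, and these classes form a basis. *)
Definition quotient_basis U W S : Prop :=
  [/\ forall v, S v -> U v, independent_mod W S & spanning_mod U W S].

End LinearAlgebra.

Section Polynomials.
Variable N : nat.
Implicit Types (D : {set 'I_N}) (f g p : {mpoly rat[N]}).

(* The subalgebra Q[z_i : i in D] of Q[z_0, ..., z_(N-1)]. *)
Definition poly_in D p : Prop :=
  forall m, m \in msupp p -> forall i, i \notin D -> m i = 0%N.

(* Lambda[z_D]^+ *)
Definition symmetric_pos D p : Prop :=
  [/\ poly_in D p, forall s : 'S_N, perm_on D s -> msym s p = p
    & p@_0%MM = 0].

(* The ideal of Q[z_D] generated by Lambda[z_D]^+. *)
Definition coinvariant_ideal D p : Prop :=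
  exists s : seq ({mpoly rat[N]} * {mpoly rat[N]}),
    (forall t, t \in s -> poly_in D t.1 /\ symmetric_pos D t.2) /\
    p = \sum_(t <- s) t.1 * t.2.

Definition coinvariant_basis D (S : {mpoly rat[N]} -> Prop) : Prop :=
  quotient_basis (poly_in D) (coinvariant_ideal D) S.

(* f(d/dz_0, ..., d/dz_(N-1)) g *)
Definition diff_apply f g : {mpoly rat[N]} :=
  \sum_(m <- msupp f) f@_m *: g^`M[m].

Definition pairing f g : rat := (diff_apply f g)@_0%MM.

Definition derivative_space g : {mpoly rat[N]} -> Prop :=
  lin_span (fun h => exists m : 'X_{1..N}, h = g^`M[m]).

Definition orthogonal (H : {mpoly rat[N]} -> Prop) f : Prop :=
  forall h, H h -> pairing f h = 0.

End Polynomials.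

(* Q[x_1, ..., x_n, y_1, ..., y_n] is {mpoly rat[n + n]}: the first n
   variables are the x_i, the last n the y_i.  The index set [n] is 'I_n,
   numbered from 0. *)
Section Hook.
Variable n : nat.

Definition xvar (i : 'I_n) : {mpoly rat[n + n]} := 'X_(lshift n i).
Definition yvar (i : 'I_n) : {mpoly rat[n + n]} := 'X_(rshift n i).

Definition xvars (A : {set 'I_n}) : {set 'I_(n + n)} := [set lshift n i | i in A].
Definition yvars (A : {set 'I_n}) : {set 'I_(n + n)} := [set rshift n i | i in A].

(* For 1 <= k <= n, row i is (1, y_i, ..., y_i^(n-k), x_i, ..., x_i^(k-1)). *)
Definition hook_Delta (k : nat) : {mpoly rat[n + n]} :=
  \det (\matrix_(i < n, j < n)
     if (j <= n - k)%N then yvar i ^+ j else xvar i ^+ (j - (n - k))).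

Definition hook_H (k : nat) : {mpoly rat[n + n]} -> Prop :=
  derivative_space (hook_Delta k).

Definition hook_J (k : nat) : {mpoly rat[n + n]} -> Prop :=
  orthogonal (hook_H k).

Definition hook_basis (k : nat) (S : {mpoly rat[n + n]} -> Prop) : Prop :=
  quotient_basis (fun _ => True) (hook_J k) S.

(* \bar A = [n] \ (A u {c}) *)
Definition hook_compl (A : {set 'I_n}) (c : 'I_n) : {set 'I_n} := ~: (c |: A).

Definition hook_monomial (A : {set 'I_n}) (c : 'I_n) : {mpoly rat[n + n]} :=
  (\prod_(i in A | (c < i)%N) xvar i) * (\prod_(j in hook_compl A c | (j < c)%N) yvar j).

End Hook.

(* Main.v *)
Require Import Defs.
From mathcomp Require Import all_boot all_order all_algebra all_fingroup.
From mathcomp Require Import mpoly ssrcomplements ring zify.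
From Stdlib Require Import ClassicalEpsilon.

(** The ideal [J] is the annihilator of the hook determinant [Delta] under
    differentiation, so the claim is that the proposed products act on [Delta]
    with linearly independent results and generate everything modulo [J].  No
    dimension is computed: the two halves are triangularity statements for one
    and the same order, which is why the bases of the coinvariant algebras may
    be arbitrary.

    A pair [(c, A)] is read as a word of length [n]: the letter at [i] is x if
    [i] is in [A], c if [i = c] and y otherwise.  Words are compared
    lexicographically with x < c < y.  The monomial [m_w] of the word [w]
    consists of the x after the letter c and the y before it ([crossing]); let
    [n_w] be the complementary monomial, the x before c and the y after it
    ([cocrossing]), so that [n_w * m_w] is the product of all x and all y of
    the word.  Each term of [Delta] involves exactly [k - 1] of the x-variables
    and [n - k] of the y-variables, at disjoint positions; hence [x_i * y_i]
    and products of [k] distinct x-variables or [n - k + 1] distinct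
    y-variables annihilate [Delta] ([kills_xy], [kills_many]).  So do the
    symmetric polynomials without constant term in all x or in all y, because
    [Delta] alternates and its exponents cannot become smaller without
    coinciding ([kills_symmetric]).

    Generation.  Multiplying [m_w] by some [x_i] with [i] outside [A], or some
    [y_j] with [j] outside the y-positions, gives an element of [J] or a
    multiple of [m_w'] for a larger word [w'] ([straighten]).  A symmetric
    polynomial in the x of [A] is the restriction of one in all x
    ([symmetric_pos_lift]), hence multiplies [m_w] into [J] plus the span for
    larger words.  So modulo larger words [m_w] only sees the two coinvariant
    algebras of [w].  The smallest word has [m_w = 1], and descending induction
    on words shows that all polynomials are reached ([spanned_all]).

    Independence.  If [u < w] then [n_u * m_w] lies in [J] ([kills_cocrossing]).
    Multiplying a vanishing combination by [n_u], where [u] is the smallest word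
    that occurs, therefore leaves a combination [F] of products [b * b'] that
    annihilates the derivative of [Delta] by all x and all y of [u].  This
    derivative ([face]) is up to a scalar the product of the Vandermonde
    determinants in these variables.  What is used of it is only that it is
    alternating with staircase exponents in either group of variables
    ([face_vandermonde]).  For such a polynomial the annihilator in the
    variables of the group is the coinvariant ideal
    ([annihilator_coinvariant]), and this forces [F] to have zero coefficients
    ([product_independent]). *)

Set Implicit Arguments.
Unset Strict Implicit.
Unset Printing Implicit Defensive.

Import GRing.Theory Num.Theory.
Local Open Scope ring_scope.

Local Notation "m # s" := [multinom m (s i) | i < _]
  (at level 40, left associativity, format "m # s").

(** * Polynomials acting as differential operators *)

Section DiffApply.
Variable N : nat.
Implicit Types (f g h p : {mpoly rat[N]}) (m : 'X_{1..N}) (s : 'S_N).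

Lemma diff_applyE K f g : (msize f <= K)%N ->
  diff_apply f g = \sum_(m : 'X_{1..N < K}) f@_m *: g^`M[m].
Proof.
move=> le_fK; rewrite /diff_apply (big_mksub 'X_{1..N < K}) /=; first last.
- by move=> m /msize_mdeg_lt /leq_trans; apply.
- exact: msupp_uniq.
by rewrite big_rmcond //= => m /memN_msupp_eq0 ->; rewrite scale0r.
Qed.

Lemma diff_apply_linearl g c f h :
  diff_apply (c *: f + h) g = c *: diff_apply f g + diff_apply h g.
Proof.
pose K := maxn (msize (c *: f + h)) (maxn (msize f) (msize h)).
rewrite !(@diff_applyE K) ?leq_max ?leqnn ?orbT //.
rewrite scaler_sumr -big_split /=; apply: eq_bigr => m _.
by rewrite mcoeffD mcoeffZ scalerDl scalerA.
Qed.

Lemma diff_applyDl f h g :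
  diff_apply (f + h) g = diff_apply f g + diff_apply h g.
Proof. by rewrite -{1}[f]scale1r diff_apply_linearl scale1r. Qed.

Lemma diff_apply0l g : diff_apply 0 g = 0.
Proof. by rewrite /diff_apply msupp0 big_nil. Qed.

Lemma diff_applyZl c f g : diff_apply (c *: f) g = c *: diff_apply f g.
Proof. by rewrite -[c *: f]addr0 diff_apply_linearl diff_apply0l addr0. Qed.

Lemma diff_applyBl f h g :
  diff_apply (f - h) g = diff_apply f g - diff_apply h g.
Proof. by rewrite -scaleN1r diff_applyDl diff_applyZl scaleN1r. Qed.

Lemma diff_apply_suml I (r : seq I) (P : pred I) F g :
  diff_apply (\sum_(i <- r | P i) F i) g = \sum_(i <- r | P i) diff_apply (F i) g.
Proof.
apply: (big_morph (fun f => diff_apply f g)) => [f h|];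
by rewrite (diff_applyDl, diff_apply0l).
Qed.

Lemma diff_apply_linearr f c g h :
  diff_apply f (c *: g + h) = c *: diff_apply f g + diff_apply f h.
Proof.
rewrite /diff_apply scaler_sumr -big_split /=; apply: eq_bigr => m _.
by rewrite mderivmD mderivmZ scalerDr !scalerA mulrC.
Qed.

Lemma diff_applyr0 f : diff_apply f 0 = 0.
Proof. by rewrite /diff_apply big1 // => m _; rewrite raddf0 scaler0. Qed.

Lemma diff_applyZr f c g : diff_apply f (c *: g) = c *: diff_apply f g.
Proof. by rewrite -[c *: g]addr0 diff_apply_linearr diff_applyr0 addr0. Qed.

Lemma diff_applyNr f g : diff_apply f (- g) = - diff_apply f g.
Proof. by rewrite -scaleN1r diff_applyZr scaleN1r. Qed.

Lemma diff_applyX m g : diff_apply 'X_[m] g = g^`M[m].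
Proof. by rewrite /diff_apply msuppX big_seq1 mcoeffX eqxx scale1r. Qed.

(** Partial derivatives commute, so polynomials act as a commutative ring;
    annihilators are therefore ideals. *)
Lemma diff_applyM f h g : diff_apply (f * h) g = diff_apply f (diff_apply h g).
Proof.
elim/mpolyind: f => [|c m f _ _ IHf]; first by rewrite mul0r !diff_apply0l.
rewrite mulrDl !diff_applyDl IHf -scalerAl !diff_applyZl; congr (_ *: _ + _).
elim/mpolyind: h {IHf} => [|d m' h _ _ IHh].
  by rewrite mulr0 !diff_apply0l diff_applyr0.
rewrite mulrDr !diff_applyDl IHh -scalerAr !diff_applyZl diff_apply_linearr.
by rewrite -mpolyXD !diff_applyX addmC mderivmDm.
Qed.

Lemma mcoeff_diff_apply f g m : (diff_apply f g)@_m =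
  \sum_(u <- msupp f)
    f@_u * (g@_(u + m) *+ (\prod_(i < N) ((u + m)%MM i) ^_ (u i))).
Proof.
rewrite raddf_sum /=; apply: eq_bigr => u _.
by rewrite mcoeffZ mcoeff_mderivm.
Qed.

Lemma msupp_diff_apply f g m : m \in msupp (diff_apply f g) ->
  exists2 u, u \in msupp f & (u + m)%MM \in msupp g.
Proof.
rewrite mcoeff_msupp mcoeff_diff_apply => nz.
have /hasP[u uf ug] : has (fun u => (u + m)%MM \in msupp g) (msupp f).
  apply: contraNT nz => /hasPn noU; rewrite big_seq big1 // => u /noU.
  by move/memN_msupp_eq0->; rewrite mul0rn mulr0.
by exists u.
Qed.

Lemma ffact_prod_neq0 u m :
  (\prod_(i < N) ((u + m)%MM i) ^_ (u i) != 0)%N.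
Proof.
rewrite -lt0n prodn_gt0 // => i.
by rewrite ffact_gt0 mnmDE leq_addr.
Qed.

(** In characteristic 0 no monomial is lost: the falling factorials that
    differentiation produces are nonzero. *)
Lemma msupp_mderivm g u m : (m \in msupp g^`M[u]) = ((u + m)%MM \in msupp g).
Proof.
rewrite !mcoeff_msupp mcoeff_mderivm -mulr_natr mulf_eq0 pnatr_eq0.
by rewrite (negbTE (ffact_prod_neq0 u m)) orbF.
Qed.

(** Renaming variables in operator and argument simultaneously renames them in
    the result. This transports the alternation of [g] to its derivatives by
    invariant polynomials. *)
Lemma msym_diff_apply s f g :
  msym s (diff_apply f g) = diff_apply (msym s f) (msym s g).
Proof.
elim/mpolyind: f => [|c u f _ _ IHf]; first by rewrite msym0 !diff_apply0l msym0.
rewrite msymD !diff_applyDl msymD IHf msymZ !diff_applyZl msymZ.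
congr (_ *: _ + _); rewrite msymX !diff_applyX; apply/mpolyP => m.
rewrite mcoeff_sym !mcoeff_mderivm mcoeff_sym.
have -> : (u#(s^-1)%g + m)%MM#s = (u + m#s)%MM.
  by apply/mnmP => i; rewrite !(mnmE, mnmDE) permK.
congr (_ *+ _); rewrite [RHS](reindex_inj (@perm_inj _ s)) /=.
by apply: eq_bigr => i _; rewrite !(mnmE, mnmDE) permK.
Qed.

(** One device for three purposes: restricting a polynomial to some of its
    monomials, slicing it, and dividing each coefficient by a number depending
    on the monomial. *)
Definition reweight (phi : 'X_{1..N} -> rat) p : {mpoly rat[N]} :=
  \sum_(m <- msupp p) (phi m * p@_m) *: 'X_[m].

Lemma mcoeff_reweight phi p m : (reweight phi p)@_m = phi m * p@_m.
Proof.
rewrite raddf_sum /= (eq_bigr (fun u => if u == m then phi m * p@_m else 0)).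
  rewrite -big_mkcond big_const_seq /=; case: (boolP (m \in msupp p)) => mp.
    rewrite (count_uniq_mem _ (msupp_uniq p)) mp /= addr0 //.
  by rewrite (count_uniq_mem _ (msupp_uniq p)) (negbTE mp) /= memN_msupp_eq0 // mulr0.
by move=> u _; rewrite mcoeffZ mcoeffX; case: eqP => [->|]; rewrite ?mulr1 ?mulr0.
Qed.

Lemma msupp_reweight phi p m : m \in msupp (reweight phi p) ->
  phi m != 0 /\ m \in msupp p.
Proof.
rewrite !mcoeff_msupp mcoeff_reweight mulf_eq0 negb_or.
by move=> /andP.
Qed.

End DiffApply.

(** * Polynomials in part of the variables *)

Section PolyIn.
Variable N : nat.
Implicit Types (D : {set 'I_N}) (f g p q : {mpoly rat[N]}) (m : 'X_{1..N}).

Lemma poly_in0 D : poly_in D (0 : {mpoly rat[N]}).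
Proof. by move=> m; rewrite msupp0. Qed.

Lemma poly_inD D p q : poly_in D p -> poly_in D q -> poly_in D (p + q).
Proof.
by move=> Dp Dq m /msuppD_le; rewrite mem_cat => /orP[/Dp|/Dq].
Qed.

Lemma poly_inZ D c p : poly_in D p -> poly_in D (c *: p).
Proof. by move=> Dp m /msuppZ_le /Dp. Qed.

Lemma poly_inB D p q : poly_in D p -> poly_in D q -> poly_in D (p - q).
Proof. by move=> Dp Dq; rewrite -scaleN1r; apply/poly_inD/poly_inZ. Qed.

Lemma poly_inM D p q : poly_in D p -> poly_in D q -> poly_in D (p * q).
Proof.
move=> Dp Dq m /msuppM_le /allpairsP[[u v] /= [up vq ->]] i iD.
by rewrite mnmDE (Dp u) // (Dq v).
Qed.

Lemma poly_in_sum (I : eqType) (r : seq I) (P : pred I) F D :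
  (forall i, i \in r -> P i -> poly_in D (F i)) ->
  poly_in D (\sum_(i <- r | P i) F i).
Proof.
move=> DF; rewrite big_seq_cond; elim/big_ind: _ => [|p q|i /andP[]].
- exact: poly_in0.
- exact: poly_inD.
- exact: DF.
Qed.

Lemma poly_inX D m : (forall i, i \notin D -> m i = 0%N) -> poly_in D 'X_[m].
Proof. by move=> Dm u; rewrite msuppX inE => /eqP->. Qed.

Lemma poly_inW D D' p : D \subset D' -> poly_in D p -> poly_in D' p.
Proof.
move=> /subsetP sDD' Dp m mp i iD'; apply: Dp => //.
by apply: contra iD'; apply: sDD'.
Qed.

Lemma poly_in_sym D s p : perm_on D s -> poly_in D p -> poly_in D (msym s p).
Proof.
move=> Ds Dp m; rewrite mcoeff_msupp mcoeff_sym -mcoeff_msupp => /Dp m0 i iD.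
by have := m0 i iD; rewrite mnmE (out_perm Ds).
Qed.

Lemma msym_tperm_id D p i j : i \notin D -> j \notin D -> poly_in D p ->
  msym (tperm i j) p = p.
Proof.
move=> iD jD Dp; apply/mpolyP => m; rewrite mcoeff_sym.
have [mij|mij] := boolP ((m i == 0%N) && (m j == 0%N)).
  congr (_@_ _); apply/mnmP => l; rewrite mnmE.
  by case/andP: mij => /eqP mi /eqP mj; case: tpermP => [->|->|]; rewrite ?mi ?mj.
rewrite !memN_msupp_eq0 //.
  by apply: contra mij => /Dp m0; rewrite !m0.
apply: contra mij => /Dp m0; have := m0 i iD; have := m0 j jD.
by rewrite !mnmE tpermL tpermR => -> ->.
Qed.

Lemma poly_in_split D d p : poly_in D p -> d \in D ->
  exists p0 q, [/\ poly_in (D :\ d) p0, poly_in D q & p = p0 + 'X_d * q].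
Proof.
move=> Dp dD; exists (\sum_(m <- msupp p | m d == 0%N) p@_m *: 'X_[m]).
exists (\sum_(m <- msupp p | m d != 0%N) p@_m *: 'X_[m - U_(d)]); split.
- apply: poly_in_sum => m mp /eqP md; apply/poly_inZ/poly_inX => i.
  by rewrite !inE negb_and negbK => /orP[/eqP->//|]; apply: Dp.
- apply: poly_in_sum => m mp _; apply/poly_inZ/poly_inX => i iD.
  by rewrite mnmBE (Dp m mp).
rewrite {1}[p]mpolyE (bigID (fun m : 'X_{1..N} => m d == 0%N)) /=.
congr (_ + _); rewrite mulr_sumr; apply: eq_bigr => m md.
by rewrite -scalerAr -mpolyXD addmC submK // lep1mP.
Qed.

Lemma poly_in_factor D d p : poly_in D p -> d \in D ->
  (forall m, m \in msupp p -> m d != 0%N) ->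
  exists2 q, poly_in D q & p = 'X_d * q.
Proof.
move=> Dp dD pd; exists (\sum_(m <- msupp p) p@_m *: 'X_[m - U_(d)]).
  apply: poly_in_sum => m mp _; apply/poly_inZ/poly_inX => i iD.
  by rewrite mnmBE (Dp m mp).
rewrite {1}[p]mpolyE mulr_sumr big_seq [RHS]big_seq; apply: eq_bigr => m mp.
by rewrite -scalerAr -mpolyXD addmC submK // lep1mP pd.
Qed.

Lemma coinvariant_ideal0 D : coinvariant_ideal D (0 : {mpoly rat[N]}).
Proof. by exists [::]; split=> //; rewrite big_nil. Qed.

Lemma coinvariant_idealD D p q :
  coinvariant_ideal D p -> coinvariant_ideal D q -> coinvariant_ideal D (p + q).
Proof.
move=> [s [Ds ->]] [t [Dt ->]]; exists (s ++ t); split; last by rewrite big_cat.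
by move=> u; rewrite mem_cat => /orP[/Ds|/Dt].
Qed.

Lemma coinvariant_idealM D p q :
  poly_in D p -> coinvariant_ideal D q -> coinvariant_ideal D (p * q).
Proof.
move=> Dp [s [Ds ->]]; exists [seq (p * t.1, t.2) | t <- s]; split.
  by move=> _ /mapP[t /Ds[D1 D2] ->]; split=> //; apply: poly_inM.
by rewrite big_map mulr_sumr; apply: eq_bigr => t _; rewrite mulrA.
Qed.

Lemma coinvariant_ideal_sym D p : symmetric_pos D p -> coinvariant_ideal D p.
Proof.
move=> Dp; exists [:: (1, p)]; rewrite big_seq1 mul1r; split=> // t.
rewrite inE => /eqP->; split=> //=; rewrite -mpolyX0; apply: poly_inX => i _.
by rewrite mnm0E.
Qed.

End PolyIn.

(** * Extending symmetric polynomials to more variables *)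

Section Lifting.
Variable N : nat.
Implicit Types (D : {set 'I_N}) (f g p q : {mpoly rat[N]}) (m : 'X_{1..N}).

(** Summing over the transpositions [(d e)] symmetrizes [f] over the larger
    set, since these are coset representatives. Among the monomials free of
    [d], the monomial [m] is then counted once for each [e] with [m e = 0];
    dividing the coefficients by this number beforehand makes the monomials
    free of [d] reproduce [f]. *)
Lemma symmetric_pos_extend D d f : d \notin D -> symmetric_pos D f ->
  exists2 t, symmetric_pos (d |: D) t
    & forall m, m \in msupp (f - t) -> m d != 0%N.
Proof.
move=> dD [Df symf f0].
pose Z m := [set e in d |: D | m e == 0%N].
pose h := reweight (fun m => (#|Z m|%:R)^-1) f.
have Dh : poly_in D h by move=> m /msupp_reweight[_ /Df].
have h_sym s : perm_on D s -> msym s h = h.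
  move=> Ds; apply/mpolyP => m; rewrite mcoeff_sym !mcoeff_reweight.
  rewrite -mcoeff_sym (symf s Ds); congr (_%:R^-1 * _).
  rewrite -(card_preimset (Z m) (@perm_inj _ s)); apply: eq_card => e.
  rewrite !inE mnmE (perm_closed _ Ds); congr ((_ || _) && _).
  apply/eqP/eqP => [->|se]; first exact: out_perm Ds dD.
  by apply: (@perm_inj _ s); rewrite se (out_perm Ds dD).
have tperm_onD e : e \in d |: D -> perm_on (d |: D) (tperm d e).
  move=> eD; apply/subsetP => i; rewrite inE.
  by case: tpermP => [->|->|]; rewrite ?eqxx ?setU11.
exists (\sum_(e in d |: D) msym (tperm d e) h).
  split.
  - apply: poly_in_sum => e _ eD; apply: poly_in_sym (tperm_onD e eD) _.
    exact: poly_inW (subsetUr _ _) Dh.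
  - move=> s Ds; rewrite raddf_sum /= [RHS](reindex_inj (@perm_inj _ s)) /=.
    apply: eq_big => [e|e eD]; first by rewrite (perm_closed _ Ds).
    rewrite -msymMm.
    (* the first factor fixes [d] and permutes [D], so it leaves [h]
       invariant *)
    have -> : (tperm d e * s = (tperm d e * s * tperm d (s e)) * tperm d (s e))%g.
      by rewrite -mulgA tperm2 mulg1.
    rewrite msymMm h_sym //; apply/subsetP => i; rewrite inE.
    have seD : s e \in d |: D by rewrite (perm_closed _ Ds).
    have [->|nid] := eqVneq i d.
      by rewrite !permM tpermL tpermR eqxx.
    apply: contraR => iD; have iD' : i \notin d |: D by rewrite !inE negb_or nid.
    rewrite !permM (out_perm (tperm_onD e eD) iD') (out_perm Ds iD').
    by rewrite (out_perm (tperm_onD _ seD) iD').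
  - rewrite raddf_sum /= big1 // => e _; rewrite mcoeff_sym mcoeff_reweight.
    rewrite (_ : 0%MM#_ = 0%MM) ?f0 ?mulr0 //.
    by apply/mnmP => i; rewrite !mnmE.
move=> m; apply: contraTneq => md; rewrite -mcoeff_eq0 mcoeffB raddf_sum /=.
rewrite (bigID (fun e => m e == 0%N)) /= [X in _ - (_ + X)]big1 ?addr0; last first.
  move=> e /andP[_ me]; rewrite mcoeff_sym memN_msupp_eq0 //.
  by apply: contra me => /Dh/(_ d dD); rewrite mnmE tpermL => ->.
rewrite (eq_bigr (fun=> h@_m)) => [|e /andP[_ /eqP me]].
  rewrite (eq_bigl (mem (Z m))) => [|e]; last by rewrite !inE.
  rewrite sumr_const mcoeff_reweight -[X in _ - X]mulr_natl mulrA mulfV ?mul1r ?subrr //.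
  by rewrite pnatr_eq0 -lt0n; apply/card_gt0P; exists d; rewrite !inE eqxx md.
rewrite mcoeff_sym; congr (_@_ _); apply/mnmP => i; rewrite mnmE.
by case: tpermP => [->|->|]; rewrite ?md ?me.
Qed.

(** The variables are added one at a time; each correction only involves
    monomials divisible by the variable just added. *)
Lemma symmetric_pos_lift D D' f : D \subset D' -> symmetric_pos D f ->
  exists2 t, symmetric_pos D' t
    & forall m, m \in msupp (f - t) -> exists2 i, i \in D' :\: D & m i != 0%N.
Proof.
move: {2}#|D' :\: D| (leqnn #|D' :\: D|) => r.
elim: r D f => [|r IHr] D f.
  rewrite leqn0 cards_eq0 setD_eq0 => sD'D sDD' fD.
  exists f; last by rewrite subrr msupp0.
  by rewrite (_ : D' = D) //; apply/eqP; rewrite eqEsubset sD'D.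
move=> ler sDD' fD; have [D0|[d dDD]] := set_0Vmem (D' :\: D).
  by apply: IHr; rewrite // D0 cards0.
have [dD' dD] := setDP dDD.
have [t tD tf] := symmetric_pos_extend dD fD.
have sdDD' : d |: D \subset D' by rewrite subUset sub1set dD'.
have [|u uD ut] := IHr (d |: D) t _ sdDD' tD.
  rewrite -ltnS (leq_trans _ ler) // proper_card // properE; apply/andP; split.
    by apply: setDS; apply: subsetUr.
  by apply/subsetPn; exists d; rewrite // !inE eqxx.
exists u => // m; rewrite -[f](subrK t) -addrA => /msuppD_le.
rewrite mem_cat => /orP[/tf md|/ut[i]]; first by exists d.
by rewrite !inE negb_or => /andP[/andP[_ iD] iD'] mi; exists i; rewrite // !inE iD.
Qed.

End Lifting.

(** * Annihilators of Vandermonde-like polynomials *)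

Section Staircase.

(** Distinct exponents bounded by the staircase exponents [0, 1, 2, ...] must
    equal them: a smaller value is already taken, by induction on the value.
    This is why an alternating polynomial cannot have lower degree than the
    Vandermonde determinant. *)
Lemma staircase_rigid (I : finType) (Z : {pred I}) (mu m : I -> nat) :
  (forall i v, i \in Z -> (v < mu i)%N -> exists2 j, j \in Z & mu j = v) ->
  (forall i, i \in Z -> (m i <= mu i)%N) -> {in Z &, injective m} ->
  {in Z, m =1 mu}.
Proof.
move=> full le_m inj_m i; move: {2}(mu i) (erefl (mu i)) => v.
elim/ltn_ind: v i => v IHv i mui iZ; apply/eqP; rewrite eqn_leq le_m //= leqNgt.
apply/negP => lt_m; have [j jZ muj] := full i (m i) iZ lt_m.
have mj : m j = mu j by apply: (IHv (m i)); rewrite // -mui.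
have ij : i = j by apply: inj_m; rewrite // mj muj.
by move: lt_m; rewrite -muj ij ltnn.
Qed.

Variable N : nat.
Implicit Types (D : {set 'I_N}) (f g p q : {mpoly rat[N]}) (m : 'X_{1..N}).

Definition alternating D g :=
  forall i j, i \in D -> j \in D -> i != j -> msym (tperm i j) g = - g.

(** Since only [#|D|] exponents are available, taking all these values makes
    [m] a bijection from [D] onto the interval. *)
Definition staircase D m := forall v, (v < #|D|)%N -> exists2 i, i \in D & m i = v.

(** The multiples of the Vandermonde determinant in the variables of [D] by
    polynomials in the other variables. This form of the definition is
    inherited by derivatives without any explicit formula. *)
Definition vandermonde_like D g :=
  alternating D g /\ forall m, m \in msupp g -> staircase D m.

Lemma staircase_inj D m : staircase D m -> {in D &, injective m}.
Proof.
move=> stm; apply/dinjectiveP; rewrite /dinjectiveb.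
apply: (@leq_size_uniq _ (iota 0 #|D|)); rewrite ?iota_uniq //.
  move=> v; rewrite mem_iota add0n => /stm[i iD <-].
  by apply: map_f; rewrite mem_enum.
by rewrite size_map size_iota cardE.
Qed.

Lemma staircase_lt D m i : staircase D m -> i \in D -> (m i < #|D|)%N.
Proof.
move=> stm iD; rewrite ltnNge; apply/negP => le_m.
have sub : {subset m i :: iota 0 #|D| <= [seq m i | i <- enum D]}.
  move=> v; rewrite inE mem_iota add0n => /orP[/eqP->|/stm[j jD <-]].
    by apply: map_f; rewrite mem_enum.
  by apply: map_f; rewrite mem_enum.
have /uniq_leq_size/(_ sub) : uniq (m i :: iota 0 #|D|).
  by rewrite /= iota_uniq mem_iota add0n ltnNge le_m.
by rewrite /= size_map size_iota -cardE ltnn.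
Qed.

Lemma alternating_coeff D g i j m : alternating D g ->
  i \in D -> j \in D -> i != j -> g@_(m#(tperm i j)) = - g@_m.
Proof. by move=> altg iD jD nij; rewrite -mcoeff_sym altg // mcoeffN. Qed.

Lemma alternating_inj D g m : alternating D g -> m \in msupp g ->
  {in D &, injective m}.
Proof.
move=> altg mg i j iD jD mij; apply: contraTeq mg => nij.
have := alternating_coeff m altg iD jD nij.
rewrite (_ : m#_ = m); last first.
  by apply/mnmP => l; rewrite mnmE; case: tpermP => [->|->|].
by rewrite -mcoeff_eq0 => /eqP; rewrite -addr_eq0 -mulr2n mulrn_eq0.
Qed.

Lemma alternating_diff_apply D f g :
  (forall i j, i \in D -> j \in D -> msym (tperm i j) f = f) ->
  alternating D g -> alternating D (diff_apply f g).
Proof.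
by move=> fD gD i j iD jD nij; rewrite msym_diff_apply fD // gD // diff_applyNr.
Qed.

Lemma perm_on_tperm D i j : i \in D -> j \in D -> perm_on D (tperm i j).
Proof.
move=> iD jD; apply/subsetP => l; rewrite inE.
by case: tpermP => [->|->|]; rewrite ?eqxx.
Qed.

(** A derivative of [g] by a symmetric polynomial alternates, so its exponents
    on [D] are distinct; being bounded by staircase exponents they cannot have
    dropped. *)
Lemma symmetric_pos_kills D f g :
  symmetric_pos D f -> vandermonde_like D g -> diff_apply f g = 0.
Proof.
move=> [Df symf f0] [altg stg]; apply/eqP; apply: contraT => nz.
have [m mh] : exists m, m \in msupp (diff_apply f g).
  by move: nz; rewrite -msupp_eq0; case: (msupp _) => // m s _; exists m; rewrite inE eqxx.
have alth : alternating D (diff_apply f g).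
  by apply: alternating_diff_apply altg => i j iD jD; apply/symf/perm_on_tperm.
have [u uf umg] := msupp_diff_apply mh.
have stum := stg _ umg.
have eq_um : {in mem D, m =1 (u + m)%MM}.
  apply: staircase_rigid => [i v iD lt_v|i _|].
  - by have lt_i := staircase_lt stum iD; apply: stum; apply: ltn_trans lt_v lt_i.
  - by rewrite mnmDE leq_addl.
  - exact: alternating_inj alth mh.
have u0 : u = 0%MM.
  apply/mnmP => i; rewrite mnm0E; have [iD|/(Df u uf)//] := boolP (i \in D).
  by apply: (@addIn (m i)); rewrite -mnmDE -eq_um.
by move: uf; rewrite mcoeff_msupp u0 f0 eqxx.
Qed.

Lemma coinvariant_ideal_kills D f g :
  coinvariant_ideal D f -> vandermonde_like D g -> diff_apply f g = 0.
Proof.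
move=> [s [sD ->]] gD; rewrite diff_apply_suml big_seq big1 // => t /sD[_ symt].
by rewrite diff_applyM (symmetric_pos_kills symt gD) diff_applyr0.
Qed.

Lemma mnm_mesym1 (S : {set 'I_N}) i : mesym1 S i = (i \in S).
Proof. by rewrite mnmE. Qed.

Lemma mesym1U (S T : {set 'I_N}) : [disjoint S & T] ->
  mesym1 (S :|: T) = (mesym1 S + mesym1 T)%MM.
Proof.
move=> dST; apply/mnmP => i; rewrite mnmDE !mnm_mesym1 inE.
by case: (boolP (i \in S)) => //= /(disjointFr dST)->.
Qed.

Lemma symmetric_pos_mesym1 D : (0 < #|D|)%N -> symmetric_pos D 'X_[mesym1 D].
Proof.
move=> D0; split.
- by apply: poly_inX => i iD; rewrite mnm_mesym1 (negbTE iD).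
- move=> s Ds; apply/mpolyP => m; rewrite mcoeff_sym !mcoeffX.
  rewrite -(inj_eq (@mperm_inj _ s) (mesym1 D) m) (_ : (mesym1 D)#s = mesym1 D) //.
  by apply/mnmP => i; rewrite mnmE !mnm_mesym1 (perm_closed _ Ds).
- have [i iD] := card_gt0P D0; rewrite mcoeffX; case: eqP => //.
  by move/(congr1 (fun m : 'X_{1..N} => m i)); rewrite mnm_mesym1 iD mnm0E.
Qed.

(** Differentiating once in every variable but [d] removes the monomials in
    which one of these has exponent 0, which leaves the monomials with
    exponent 0 at [d], and lowers the other staircase by one. *)
Lemma vandermonde_like_derivative D d g : d \in D -> vandermonde_like D g -> g != 0 ->
  vandermonde_like (D :\ d) g^`M[mesym1 (D :\ d)] /\ g^`M[mesym1 (D :\ d)] != 0.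
Proof.
move=> dD [altg stg] nzg; set e := mesym1 _.
have card_D : #|D| = #|D :\ d|.+1 by rewrite (cardsD1 d) dD.
split; last first.
  have [m0 m0g] : exists m, m \in msupp g.
    by move: nzg; rewrite -msupp_eq0; case: (msupp _) => // m s _; exists m; rewrite inE eqxx.
  have [i iD m0i] : exists2 i, i \in D & m0 i = 0%N by apply: (stg _ m0g); rewrite card_D.
  (* a transposition moves the exponent 0 of some monomial to [d] *)
  have [m mg md] : exists2 m, m \in msupp g & m d = 0%N.
    have [<-|nid] := eqVneq i d; first by exists m0.
    exists (m0#(tperm i d)); last by rewrite mnmE tpermR.
    by rewrite mcoeff_msupp (alternating_coeff m0 altg) // oppr_eq0 -mcoeff_msupp.
  have le_em : (e <= m)%MM.
    apply/mnm_lepP => j; rewrite mnm_mesym1; case: (boolP (j \in D :\ d)) => //.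
    rewrite !inE lt0n => /andP[njd jD]; apply: contra njd => /eqP mj.
    by apply/eqP/(staircase_inj (stg _ mg)); rewrite ?mj ?md.
  apply: contraTneq mg => /mpolyP/(_ (m - e)%MM)/eqP.
  by rewrite mcoeff0 mcoeff_eq0 msupp_mderivm addmC submK.
split=> [|m].
  rewrite -diff_applyX; apply: alternating_diff_apply => [i j iD jD|i j].
    have /symmetric_pos_mesym1[_ syme _] : (0 < #|D :\ d|)%N by apply/card_gt0P; exists i.
    exact: syme (perm_on_tperm iD jD).
  by rewrite !inE => /andP[_ iD] /andP[_ jD]; apply: altg.
rewrite msupp_mderivm => /stg stm v lt_v.
have [i iD] : exists2 i, i \in D & (e + m)%MM i = v.+1 by apply: stm; rewrite card_D ltnS.
rewrite mnmDE mnm_mesym1 !inE iD andbT; have [->{i iD}|nid] := eqVneq i d; last first.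
  by move=> -[mi]; exists i; rewrite // !inE nid.
rewrite add0n => md; have [j jD] : exists2 j, j \in D & (e + m)%MM j = 0%N.
  by apply: stm; rewrite card_D.
by rewrite mnmDE mnm_mesym1 !inE jD andbT; case: eqVneq => [->|] //; rewrite md.
Qed.

(** Induction on [D]. For growing [S], the polynomial [f] is rewritten modulo
    the coinvariant ideal as a multiple of the product of the variables in
    [S]; for [S = D] this product is symmetric. To enlarge [S] by [d], write
    the cofactor as [q0 + z_d * q1] with [q0] free of [d]. Multiplying by the
    variables outside [S] shows that [q0] annihilates the derivative of [g] by
    all variables but [d], so by induction [q0] is in the coinvariant ideal of
    [D] without [d], whose generators are symmetric in [D] modulo [z_d]. *)
Lemma annihilator_coinvariant D f g : vandermonde_like D g -> g != 0 ->
  poly_in D f -> diff_apply f g = 0 -> coinvariant_ideal D f.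
Proof.
move: {2}#|D| (erefl #|D|) => r; elim: r D f g => [|r IHr] D f g.
  move/eqP; rewrite cards_eq0 => /eqP-> _ nzg Df.
  have -> : f = f@_0 *: 1.
    apply/mpolyP => m; rewrite mcoeffZ mcoeff1.
    have [->|nzm] := eqVneq m 0%MM; first by rewrite mulr1.
    rewrite mulr0 memN_msupp_eq0 //; apply: contra nzm => /Df m0.
    by apply/eqP/mnmP => i; rewrite m0 ?inE // mnm0E.
  rewrite -mpolyX0 diff_applyZl diff_applyX mderivm0m => /eqP.
  rewrite mpolyX0 scaler_eq0 (negbTE nzg) orbF => /eqP->; rewrite scale0r.
  exact: coinvariant_ideal0.
move=> cardD gD nzg Df fg.
suff loop (S : {set 'I_N}) : S \subset D -> exists2 q, poly_in D q
    & coinvariant_ideal D (f - 'X_[mesym1 S] * q).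
  have [q Dq fq] := loop D (subxx _).
  rewrite -[f](subrK ('X_[mesym1 D] * q)); apply: coinvariant_idealD fq _.
  rewrite mulrC; apply: coinvariant_idealM => //.
  by apply/coinvariant_ideal_sym/symmetric_pos_mesym1; rewrite cardD.
move: {2}#|S| (erefl #|S|) => c; elim: c S => [|c IHc] S.
  move/eqP; rewrite cards_eq0 => /eqP-> _; exists f => //.
  by rewrite mesym1_set0 mpolyX0 mul1r subrr; apply: coinvariant_ideal0.
move=> cardS sSD; have [d dS] : exists d, d \in S by apply/card_gt0P; rewrite cardS.
have dD := subsetP sSD d dS.
have [||q Dq fq] := IHc (S :\ d).
- by move: cardS; rewrite (cardsD1 d) dS => -[].
- exact: subset_trans (subsetDl _ _) sSD.
have [q0 [q1 [Dq0 Dq1 qE]]] := poly_in_split Dq dD.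
have [Dd_like nzDd] := vandermonde_like_derivative dD gD nzg.
have : diff_apply ('X_[mesym1 (S :\ d)] * q) g = 0.
  have := coinvariant_ideal_kills fq gD; rewrite diff_applyBl fg sub0r => /eqP.
  by rewrite oppr_eq0 => /eqP.
(* after multiplication by the variables outside [S] the term with [z_d]
   contains all variables of [D], so it annihilates [g] *)
move/(congr1 (diff_apply 'X_[mesym1 (D :\: S)])); rewrite diff_applyr0 -diff_applyM.
rewrite mulrA -mpolyXD -mesym1U; last first.
  by rewrite disjoint_sym disjoints_subset; apply/subsetP => i; rewrite !inE => /andP[_ ->].
have -> : (D :\: S) :|: (S :\ d) = D :\ d.
  apply/setP => i; rewrite !inE; have [->|_ /=] := eqVneq i d; first by rewrite dS.
  by case: (boolP (i \in S)) => /= [/(subsetP sSD)->|_]; rewrite ?orbF.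
rewrite qE mulrDr mulrA diff_applyDl -mpolyXD addmC -mesym1_set1 -mesym1U; last first.
  by rewrite disjoints1 !inE eqxx.
rewrite setD1K // ['X_[mesym1 D] * _]mulrC [X in _ + X]diff_applyM.
rewrite (symmetric_pos_kills (symmetric_pos_mesym1 _) gD) ?cardD //.
rewrite diff_applyr0 addr0 mulrC diff_applyM diff_applyX => q0g.
have cardDd : #|D :\ d| = r by move: cardD; rewrite (cardsD1 d) dD => -[].
have [s [sD q0E]] := IHr _ _ _ cardDd Dd_like nzDd Dq0 q0g.
have [q2 Dq2 q02] : exists2 q2, poly_in D q2 & coinvariant_ideal D (q0 - 'X_d * q2).
  rewrite {}q0E; elim: s sD => [|t s IHs] sD.
    exists 0; first exact: poly_in0.
    by rewrite big_nil mulr0 subrr; apply: coinvariant_ideal0.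
  have [u us|q2 Dq2 sq2] := IHs; first by apply: sD; rewrite inE us orbT.
  have [Dt1 symt] := sD t (mem_head _ _).
  have [t' symt' t'd] := symmetric_pos_extend (negbT (setD11 d D)) symt.
  rewrite setD1K // in symt'.
  have DdW := poly_inW (subsetDl D [set d]).
  have [|q3 Dq3 q3E] := poly_in_factor _ dD t'd.
    by apply: poly_inB; [apply: DdW; case: symt | case: symt'].
  exists (t.1 * q3 + q2); first by apply: poly_inD => //; apply: poly_inM => //; apply: DdW.
  rewrite big_cons mulrDr (mulrCA _ t.1) -q3E mulrBr opprD addrACA opprB.
  rewrite [t.1 * t.2 + _]addrC subrK; apply: coinvariant_idealD sq2.
  by apply: coinvariant_idealM (DdW _ Dt1) _; apply: coinvariant_ideal_sym.
exists (q2 + q1); first exact: poly_inD.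
have -> : f - 'X_[mesym1 S] * (q2 + q1) =
    (f - 'X_[mesym1 (S :\ d)] * q) + 'X_[mesym1 (S :\ d)] * (q0 - 'X_d * q2).
  rewrite -{1}(setD1K dS) mesym1U ?disjoints1 ?setD11 // mesym1_set1 mpolyXD qE.
  by ring.
apply: coinvariant_idealD fq _; apply: coinvariant_idealM q02.
apply: poly_inX => i iD; rewrite mnm_mesym1 (_ : _ \in _ = false) //.
by apply: contraNF iD; rewrite !inE => /andP[_ /(subsetP sSD)].
Qed.

End Staircase.

(** * Products of two coinvariant bases *)

Section Tensor.
Variable N : nat.
Implicit Types (D : {set 'I_N}) (f g p q : {mpoly rat[N]}) (m : 'X_{1..N}).

Definition agree_off D m0 m := [forall (i | i \notin D), m i == m0 i].

Lemma agree_offP D m0 m :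
  reflect (forall i, i \notin D -> m i = m0 i) (agree_off D m0 m).
Proof.
apply: (iffP forallP) => [eq_off i iD|eq_off i].
  by have /implyP/(_ iD)/eqP := eq_off i.
by apply/implyP => iD; rewrite eq_off.
Qed.

Definition slice D m0 g := reweight (fun m => (agree_off D m0 m)%:R) g.

Lemma mcoeff_slice D m0 g m :
  (slice D m0 g)@_m = (agree_off D m0 m)%:R * g@_m.
Proof. exact: mcoeff_reweight. Qed.

Lemma msupp_slice D m0 g m : m \in msupp (slice D m0 g) ->
  agree_off D m0 m /\ m \in msupp g.
Proof. by move/msupp_reweight; rewrite pnatr_eq0 eqb0 negbK. Qed.

Lemma slice_sum D m0 (I : Type) (r : seq I) F :
  slice D m0 (\sum_(i <- r) F i) = \sum_(i <- r) slice D m0 (F i).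
Proof.
apply/mpolyP => m; rewrite mcoeff_slice !raddf_sum mulr_sumr.
by apply: eq_bigr => i _; rewrite /= mcoeff_slice.
Qed.

(** Operators in the variables of [D] leave the other exponents alone. *)
Lemma slice_diff_apply D m0 f g : poly_in D f ->
  slice D m0 (diff_apply f g) = diff_apply f (slice D m0 g).
Proof.
move=> Df; apply/mpolyP => m; rewrite mcoeff_slice !mcoeff_diff_apply mulr_sumr.
apply: eq_big_seq => u /Df uD; rewrite mcoeff_slice mulrCA mulrnAr.
congr (_ * (_%:R * _ *+ _)); congr nat_of_bool.
apply/agree_offP/agree_offP => eq_off i iD; rewrite -?eq_off //.
  by rewrite mnmDE uD.
by rewrite mnmDE uD.
Qed.

Lemma alternating_slice D m0 g : alternating D g -> alternating D (slice D m0 g).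
Proof.
move=> altg i j iD jD nij; apply/mpolyP => m.
rewrite mcoeff_sym mcoeffN !mcoeff_slice (alternating_coeff _ altg) // mulrN.
congr (- (_%:R * _)); congr nat_of_bool.
apply/agree_offP/agree_offP => eq_off l lD; rewrite -eq_off // mnmE tpermD //.
- by apply: contraNneq lD => <-.
- by apply: contraNneq lD => <-.
- by apply: contraNneq lD => <-.
- by apply: contraNneq lD => <-.
Qed.

(** An alternating staircase polynomial with prescribed exponents outside [D]
    is determined by one coefficient: transpositions move any monomial to
    [m0], each correcting one more exponent. *)
Lemma alternating_slice_eq0 D m0 g : alternating D g -> staircase D m0 ->
  (forall m, m \in msupp g -> staircase D m /\ agree_off D m0 m) ->
  g@_m0 = 0 -> g = 0.
Proof.
move=> altg st0 gD g0; apply/mpolyP => m; rewrite mcoeff0.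
(* induction on the number of exponents that differ from those of [m0] *)
pose wrong (m : 'X_{1..N}) := [set i in D | m i != m0 i].
move: {2}#|wrong m| (leqnn #|wrong m|) => c; elim: c m => [|c IHc] m.
all: have [/gD[stm /agree_offP off]|/memN_msupp_eq0//] := boolP (m \in msupp g).
  rewrite leqn0 cards_eq0 => /eqP w0; rewrite -g0; congr (_@_ _).
  apply/mnmP => i; have [iD|/off//] := boolP (i \in D).
  by apply/eqP; apply: contraT => ne; rewrite -(in_set0 i) -w0 inE iD.
have [w0 _|[i]] := set_0Vmem (wrong m); first by apply: IHc; rewrite w0 cards0.
rewrite inE => /andP[iD ne_i] le_c.
have [j jD mj] := stm _ (staircase_lt st0 iD).
have nij : i != j by apply: contraNneq ne_i => ij; rewrite ij mj -ij.
apply/eqP; rewrite -oppr_eq0 -(alternating_coeff m altg iD jD nij); apply/eqP.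
apply: IHc; rewrite -ltnS (leq_trans _ le_c) // proper_card // properE.
apply/andP; split; last first.
  by apply/subsetPn; exists i; rewrite !inE iD //= mnmE tpermL mj eqxx.
apply/subsetP => l; rewrite !inE mnmE => /andP[lD]; rewrite lD /=.
case: tpermP => [->|-> _|//]; first by rewrite mj eqxx.
by rewrite mj; apply: contra nij => /eqP/(staircase_inj st0)->.
Qed.

(** Take a slice through a nonzero coefficient of some [G b]. All slices are
    proportional to a single Vandermonde-like [V], so a scalar combination of
    the [b] annihilates [V] and lies in the coinvariant ideal, contradicting
    independence. *)
Lemma independent_over_vandermonde D B (bs : seq {mpoly rat[N]}) G :
  independent_mod (coinvariant_ideal D) B -> (forall b, B b -> poly_in D b) ->
  uniq bs -> (forall b, b \in bs -> B b) ->
  (forall b, b \in bs -> vandermonde_like D (G b)) ->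
  \sum_(b <- bs) diff_apply b (G b) = 0 -> forall b, b \in bs -> G b = 0.
Proof.
move=> indB DB ubs bsB GD sum0 b0 b0s; apply/eqP; apply: contraT => nz.
have [m0 m0G] : exists m, m \in msupp (G b0).
  by move: nz; rewrite -msupp_eq0; case: (msupp _) => // m s _; exists m; rewrite inE eqxx.
have st0 := (GD b0 b0s).2 _ m0G.
have agree0 : agree_off D m0 m0 by apply/agree_offP.
pose V := slice D m0 (G b0); pose gam b := (G b)@_m0 / (G b0)@_m0.
have nz0 : (G b0)@_m0 != 0 by rewrite -mcoeff_msupp.
have V_D : vandermonde_like D V.
  split=> [|m /msupp_slice[_]]; first exact/alternating_slice/(GD _ b0s).1.
  exact: (GD _ b0s).2.
have nzV : V != 0.
  apply: contra_neq nz0 => /mpolyP/(_ m0).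
  by rewrite mcoeff_slice agree0 mul1r mcoeff0.
have sliceE b : b \in bs -> slice D m0 (G b) = gam b *: V.
  move=> bB; apply/eqP; rewrite -subr_eq0; apply/eqP.
  apply: (@alternating_slice_eq0 D m0) => // [i j iD jD nij|m|].
  - rewrite msymB msymZ (V_D.1 i j) // (alternating_slice _ (GD b bB).1) //.
    by rewrite scalerN opprK opprB addrC.
  - move/msuppB_le; rewrite mem_cat => /orP[/msupp_slice[am /(GD b bB).2//]|].
    by move/msuppZ_le/msupp_slice=> [am /(GD _ b0s).2].
  - by rewrite mcoeffB mcoeffZ !mcoeff_slice agree0 !mul1r divfK // subrr.
(* each [diff_apply b (G b)] may be sliced, and the slices sum to 0 *)
have killV : diff_apply (\sum_(b <- bs) gam b *: b) V = 0.
  have -> : diff_apply (\sum_(b <- bs) gam b *: b) V = slice D m0 (\sum_(b <- bs) diff_apply b (G b)).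
    rewrite diff_apply_suml slice_sum; apply: eq_big_seq => b bB.
    by rewrite (slice_diff_apply _ _ (DB b (bsB b bB))) sliceE // diff_applyZl diff_applyZr.
  by rewrite sum0; apply/mpolyP => m; rewrite mcoeff_slice mcoeff0 mulr0.
have /(indB _ _ ubs bsB)/(_ _ b0s)/eqP : coinvariant_ideal D (\sum_(b <- bs) gam b *: b).
  apply: annihilator_coinvariant V_D nzV _ killV; apply: poly_in_sum => b bB _.
  exact/poly_inZ/DB/bsB.
by rewrite /gam mulfV // oner_eq0.
Qed.

Lemma sum_by_first (T U : eqType) (V : nmodType) (s : seq (T * U)) (F : T * U -> V) :
  \sum_(t <- s) F t = \sum_(b <- undup [seq t.1 | t <- s]) \sum_(t <- s | t.1 == b) F t.
Proof.
rewrite (exchange_big_dep predT) //=; apply: eq_big_seq => t ts.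
rewrite big_mkcond (bigD1_seq t.1) ?undup_uniq ?mem_undup ?map_f //= eqxx.
by rewrite big1 ?addr0 // => b; rewrite eq_sym => /negbTE->.
Qed.

(** Grouping by the first factor gives coefficients [R b] in the variables of
    [D2]. The polynomials [R b] applied to [P] are still Vandermonde-like for
    [D1], hence vanish; so each [R b] annihilates [P], lies in the coinvariant
    ideal of [D2], and has zero coefficients. *)
Lemma product_independent D1 D2 B1 B2 P
    (s : seq ({mpoly rat[N]} * {mpoly rat[N]})) (a : {mpoly rat[N]} * {mpoly rat[N]} -> rat) :
  [disjoint D1 & D2] -> vandermonde_like D1 P -> vandermonde_like D2 P -> P != 0 ->
  independent_mod (coinvariant_ideal D1) B1 -> (forall b, B1 b -> poly_in D1 b) ->
  independent_mod (coinvariant_ideal D2) B2 -> (forall b, B2 b -> poly_in D2 b) ->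
  uniq s -> (forall t, t \in s -> B1 t.1 /\ B2 t.2) ->
  diff_apply (\sum_(t <- s) a t *: (t.1 * t.2)) P = 0 -> forall t, t \in s -> a t = 0.
Proof.
move=> dD P1 P2 nzP ind1 DB1 ind2 DB2 us sB sum0 [b0 c0] ts.
pose R b := \sum_(t <- s | t.1 == b) a t *: t.2.
have DR b : poly_in D2 (R b).
  by apply: poly_in_sum => t /sB[_ B2t] _; apply/poly_inZ/DB2.
have RP0 : diff_apply (R b0) P = 0.
  pose bs := undup [seq t.1 | t <- s].
  have mem_bs b : b \in bs -> B1 b.
    by rewrite mem_undup => /mapP[t /sB[B1t _] ->].
  apply: (independent_over_vandermonde (G := fun b => diff_apply (R b) P) ind1 DB1 (undup_uniq _) mem_bs).
  - move=> b _; split.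
      apply: alternating_diff_apply P1.1 => i j iD jD.
      by apply: msym_tperm_id (DR b); rewrite (disjointFr dD).
    move=> m /msupp_diff_apply[u uR /P1.2 st] v lt_v; have [i iD umi] := st v lt_v.
    by exists i; rewrite // -umi mnmDE (DR b u uR) // (disjointFr dD).
  - rewrite -[RHS]sum0 (sum_by_first s).
    rewrite diff_apply_suml; apply: eq_bigr => b _.
    rewrite -diff_applyM mulr_sumr; congr diff_apply; apply: eq_bigr => t /eqP <-.
    by rewrite -scalerAr; case: t.
  - by rewrite mem_undup; apply/mapP; exists (b0, c0).
have := annihilator_coinvariant P2 nzP (DR b0) RP0.
pose s0 := [seq t.2 | t <- s & t.1 == b0].
have RE : R b0 = \sum_(c <- s0) a (b0, c) *: c.
  rewrite big_map big_filter; apply: eq_bigr => t /eqP <-.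
  by case: t.
have us0 : uniq s0.
  rewrite map_inj_in_uniq ?filter_uniq // => -[b c] [b' c'].
  by rewrite !mem_filter /= => /andP[/eqP-> _] /andP[/eqP-> _] ->.
have B2s c : c \in s0 -> B2 c.
  by case/mapP=> t; rewrite mem_filter => /andP[_ /sB[_ B2t]] ->.
rewrite RE => /(ind2 _ (fun c => a (b0, c)) us0 B2s)/(_ c0); apply.
by apply/mapP; exists (b0, c0); rewrite // mem_filter eqxx.
Qed.

End Tensor.

(** * The hook determinant and its annihilator *)

(** The constant terms of all derivatives of a polynomial are its coefficients
    up to nonzero factors. *)
Lemma orthogonal_derivative_spaceP (N : nat) (f g : {mpoly rat[N]}) :
  Defs.orthogonal (derivative_space g) f <-> diff_apply f g = 0.
Proof.
have comm m : diff_apply f g^`M[m] = (diff_apply f g)^`M[m].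
  by rewrite -!diff_applyX -!diff_applyM mulrC.
split=> [orth|fg h [s [sP ->]]].
  apply/mpolyP => m; rewrite mcoeff0; apply/eqP.
  have: pairing f g^`M[m] = 0.
    apply: orth; exists [:: (1, g^`M[m])]; split; last by rewrite big_seq1 scale1r.
    by move=> t; rewrite inE => /eqP->; exists m.
  rewrite /pairing comm mcoeff_mderivm addm0 => /eqP.
  rewrite -mulr_natr mulf_eq0 pnatr_eq0.
  by have := ffact_prod_neq0 m 0%MM; rewrite addm0 => /negbTE->; rewrite orbF.
rewrite /pairing (_ : diff_apply f _ = 0) ?mcoeff0 //.
elim: s sP => [|t s IHs] sP; first by rewrite big_nil diff_applyr0.
rewrite big_cons diff_apply_linearr IHs => [|u us].
  by have [m ->] := sP t (mem_head _ _); rewrite comm fg raddf0 scaler0 addr0.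
by apply: sP; rewrite inE us orbT.
Qed.

Section Variables.
Variable n : nat.
Implicit Types (b : bool) (i j l : 'I_n) (m : 'X_{1..n + n}) (A : {set 'I_n}).

(** Both families of variables are treated at once: [false] stands for x and
    [true] for y. *)
Definition var b i : 'I_(n + n) := if b then rshift n i else lshift n i.

Lemma other_kind b b' : b' != b -> b' = ~~ b.
Proof. by case: b b' => [] []. Qed.

Lemma var_eq b b' i j : (var b i == var b' j) = (b == b') && (i == j).
Proof. by case: b b' => -[]; rewrite /= ?eq_shift. Qed.

Variant var_spec : 'I_(n + n) -> Type := VarSpec b i : var_spec (var b i).

Lemma varP u : var_spec u.
Proof.
rewrite -(splitK u); case: (split u) => i; first exact: (VarSpec false i).
exact: (VarSpec true i).
Qed.

Definition bimonom (a : bool -> 'I_n -> nat) : 'X_{1..n + n} :=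
  [multinom match split u with inl i => a false i | inr i => a true i end | u < n + n].

Lemma bimonomE a b i : bimonom a (var b i) = a b i.
Proof.
rewrite mnmE; case: b => /=; first by rewrite (unsplitK (inr i)).
by rewrite (unsplitK (inl i)).
Qed.

Lemma bimonom_eq m m' : (forall b i, m (var b i) = m' (var b i)) -> m = m'.
Proof. by move=> eqm; apply/mnmP => u; case: (varP u) => b i. Qed.

Definition vars b A : {set 'I_(n + n)} := if b then yvars A else xvars A.

Lemma in_vars b b' i A : (var b' i \in vars b A) = (b == b') && (i \in A).
Proof.
case: b b' => -[] /=.
- by rewrite mem_imset //; apply: rshift_inj.
- by apply/imsetP => -[j _ /eqP]; rewrite eq_shift.
- by apply/imsetP => -[j _ /eqP]; rewrite eq_shift.
- by rewrite mem_imset //; apply: lshift_inj.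
Qed.

Lemma card_vars b A : #|vars b A| = #|A|.
Proof.
by case: b; apply: card_imset; [apply: rshift_inj | apply: lshift_inj].
Qed.

(** The determinant alternates only under permutations acting on the x and the
    y simultaneously. *)
Definition diag_tperm i j : 'S_(n + n) :=
  (tperm (var false i) (var false j) * tperm (var true i) (var true j))%g.

Lemma tperm_var b b' i j l : tperm (var b i) (var b j) (var b' l) =
  if b == b' then var b (tperm i j l) else var b' l.
Proof.
have [<-|/negbTE nb] := eqVneq b b'; last by rewrite tpermD // var_eq nb.
by case: (tpermP i j l) => [->|->|/eqP il /eqP jl];
   rewrite ?tpermL ?tpermR // tpermD // var_eq eqxx eq_sym.
Qed.

Lemma diag_tpermE i j b l : diag_tperm i j (var b l) = var b (tperm i j l).
Proof. by rewrite permM tperm_var fun_if !tperm_var; case: b. Qed.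

Lemma diag_tperm_split b i j : diag_tperm i j =
  (tperm (var b i) (var b j) * tperm (var (~~ b) i) (var (~~ b) j))%g.
Proof.
apply/permP => u; case: (varP u) => b' l; rewrite diag_tpermE permM tperm_var.
by rewrite fun_if !tperm_var; case: b b' => [] [].
Qed.

Lemma diag_tpermV i j : ((diag_tperm i j)^-1 = diag_tperm i j)%g.
Proof.
apply: (mulgI (diag_tperm i j)); rewrite mulgV; apply/permP => u.
by case: (varP u) => b l; rewrite perm1 permM !diag_tpermE tpermK.
Qed.

End Variables.

Section Delta.
Variables (n k : nat) (hk : (1 <= k <= n)%N).
Implicit Types (b : bool) (i j l : 'I_n) (m : 'X_{1..n + n}) (s : 'S_n).

(** Column [j] of the matrix contains the monomials [x ^ a * y ^ b], where [a]
    and [b] are the values at [false] and [true]; truncated subtraction gives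
    [a = 0] on the columns of powers of y. *)
Definition hook_exp b (j : nat) : nat :=
  if b then (if (j <= n - k)%N then j else 0%N) else (j - (n - k))%N.

(** The number of columns that are powers of the given variable, including the
    common column of ones. *)
Definition arm b : nat := if b then (n - k).+1 else k.

Lemma hook_exp_xor b j : hook_exp b j != 0%N -> hook_exp (~~ b) j = 0%N.
Proof. by case: b => /=; case: leqP; lia. Qed.

Lemma hook_exp_lt b j : (hook_exp b j < arm b)%N.
Proof.
by have := ltn_ord j; case/andP: hk => k1 kn; case: b => /=; [case: (leqP j)|]; lia.
Qed.

Lemma hook_exp_inj b i j :
  hook_exp b i = hook_exp b j -> hook_exp (~~ b) i = hook_exp (~~ b) j -> i = j.
Proof. by move=> e1 e2; apply: val_inj; case: b e1 e2 => /=; case: (leqP i); case: (leqP j); lia. Qed.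

Lemma hook_exp_surj b v : (v < arm b)%N ->
  exists j, hook_exp b j = v /\ hook_exp (~~ b) j = 0%N.
Proof.
case/andP: hk => k1 kn; case: b => /= lt_v.
  have lt_n : (v < n)%N by lia.
  by exists (Ordinal lt_n) => /=; rewrite -ltnS lt_v; split=> //; lia.
case: (posnP v) => [v0|v_gt0].
  have lt_n : (0 < n)%N by lia.
  by exists (Ordinal lt_n) => /=; rewrite v0.
have lt_n : (v + (n - k) < n)%N by lia.
by exists (Ordinal lt_n) => /=; rewrite addnK; split=> //; case: leqP => //; lia.
Qed.

Definition hook_mon s : 'X_{1..n + n} := bimonom (fun b i => hook_exp b (s i)).

Lemma hook_DeltaE :
  hook_Delta n k = \sum_(s : 'S_n) (-1) ^+ s *: 'X_[hook_mon s].
Proof.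
apply: eq_bigr => s _; rewrite mulr_sign scaler_sign.
suff -> : \prod_i (\matrix_(i < n, j < n) if (j <= n - k)%N then yvar i ^+ j
    else xvar i ^+ (j - (n - k))) i (s i) = 'X_[hook_mon s] by [].
pose E i := (U_(var true i) *+ hook_exp true (s i)
             + U_(var false i) *+ hook_exp false (s i))%MM.
rewrite (eq_bigr (fun i => 'X_[E i])) => [|i _]; last first.
  rewrite mxE /E /hook_exp; case: leqP => [le_s|_].
    by rewrite (eqP le_s) mulm0n addm0 -mpolyXn.
  by rewrite mulm0n add0m -mpolyXn.
rewrite mprodXE; congr 'X_[_]; apply: bimonom_eq => b i.
rewrite bimonomE mnm_sumE (bigD1 i) //= big1 => [|j nji].
  by rewrite addn0 mnmDE !mulmnE !mnm1E !var_eq eqxx !andbT; case: b; rewrite /= ?mul1n ?mul0n ?addn0.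
by rewrite mnmDE !mulmnE !mnm1E !var_eq (negbTE nji) !andbF.
Qed.

Lemma msupp_hook_Delta m : m \in msupp (hook_Delta n k) -> exists s, m = hook_mon s.
Proof.
rewrite hook_DeltaE => /msupp_sum_le/flatten_mapP[s _].
by move/msuppZ_le; rewrite msuppX inE => /eqP->; exists s.
Qed.

Lemma hook_mon_inj : injective hook_mon.
Proof.
move=> s t /(congr1 (fun m : 'X_{1..n + n} => m)) eq_st; apply/permP => i.
apply: (@hook_exp_inj false).
  by have := bimonomE (fun b i => hook_exp b (s i)) false i;
     rewrite -/(hook_mon s) eq_st bimonomE.
by have := bimonomE (fun b i => hook_exp b (s i)) true i;
   rewrite -/(hook_mon s) eq_st bimonomE.
Qed.

Lemma hook_mon_msupp s : hook_mon s \in msupp (hook_Delta n k).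
Proof.
rewrite mcoeff_msupp hook_DeltaE raddf_sum (bigD1 s) //= big1 ?addr0.
  by rewrite mcoeffZ mcoeffX eqxx mulr1 signr_eq0.
move=> t nts; rewrite mcoeffZ mcoeffX (inj_eq hook_mon_inj) (negbTE nts).
by rewrite mulr0.
Qed.

Lemma hook_Delta_alternating i j : i != j ->
  msym (diag_tperm i j) (hook_Delta n k) = - hook_Delta n k.
Proof.
move=> nij; rewrite hook_DeltaE raddf_sum /= [in RHS](reindex_inj (mulgI (tperm i j))).
rewrite -sumrN; apply: eq_bigr => s _; rewrite msymZ msymX odd_permM odd_tperm nij.
rewrite signr_addb expr1 mulN1r scaleNr opprK; congr (_ *: 'X_[_]).
apply: bimonom_eq => b l.
by rewrite diag_tpermV mnmE diag_tpermE !bimonomE permM.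
Qed.

Lemma card_hook_exp b s : (#|[set i | hook_exp b (s i) != 0%N]| < arm b)%N.
Proof.
set T := [set _ | _]; have arm0 : (0 < arm b)%N by case: b @T => //=; case/andP: hk.
rewrite -(prednK arm0) ltnS -(size_iota 1 (arm b).-1) cardE -(size_map (fun i => hook_exp b (s i))).
apply: uniq_leq_size.
  rewrite map_inj_in_uniq ?enum_uniq // => i j; rewrite !mem_enum !inE => iT jT eij.
  by apply: (@perm_inj _ s); apply: hook_exp_inj eij _; rewrite !hook_exp_xor.
move=> v /mapP[i]; rewrite mem_enum inE mem_iota => iT ->.
by rewrite lt0n iT add1n prednK // hook_exp_lt.
Qed.

Lemma kills_monomial m : (forall s, ~~ (m <= hook_mon s)%MM) ->
  diff_apply 'X_[m] (hook_Delta n k) = 0.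
Proof.
move=> Nle; apply/eqP; rewrite -msupp_eq0 diff_applyX.
case E: (msupp _) => [//|u r]; have: u \in msupp (hook_Delta n k)^`M[m].
  by rewrite E mem_head.
rewrite msupp_mderivm => /msupp_hook_Delta[s es].
by have := Nle s; rewrite -es lem_addr.
Qed.

Lemma kills_xy m i : m (var false i) != 0%N -> m (var true i) != 0%N ->
  diff_apply 'X_[m] (hook_Delta n k) = 0.
Proof.
move=> mx my; apply: kills_monomial => s; apply/mnm_lepP => le_m.
have := le_m (var true i); have := le_m (var false i); rewrite !bimonomE.
rewrite -!lt0n in mx my => /(leq_trans mx); rewrite lt0n => /(@hook_exp_xor false)/= ->.
by rewrite leqNgt my.
Qed.

Lemma kills_many m b (T : {set 'I_n}) : (arm b <= #|T|)%N ->
  (forall i, i \in T -> m (var b i) != 0%N) ->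
  diff_apply 'X_[m] (hook_Delta n k) = 0.
Proof.
move=> le_T Tm; apply: kills_monomial => s; apply/mnm_lepP => le_m.
have := leq_trans (card_hook_exp b s) le_T; rewrite ltnNge => /negP; apply.
apply/subset_leq_card/subsetP => i /Tm; rewrite inE -!lt0n => m0.
by have := leq_trans m0 (le_m (var b i)); rewrite bimonomE.
Qed.

(** A nonzero coefficient of the derivative would belong to a monomial whose
    pairs of exponents at the [n] positions are distinct. At the positions
    where the other exponent is 0, these are distinct numbers bounded by a
    staircase, so nothing was differentiated away. *)
Lemma kills_symmetric b f : symmetric_pos (vars b setT) f ->
  diff_apply f (hook_Delta n k) = 0.
Proof.
move=> [Df symf f0]; set h := diff_apply f _.
have alt i j : i != j -> msym (diag_tperm i j) h = - h.
  move=> nij; rewrite msym_diff_apply hook_Delta_alternating // diff_applyNr.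
  congr (- diff_apply _ _).
  have fix_b : msym (tperm (var b i) (var b j)) f = f.
    by apply/symf/perm_on_tperm; rewrite in_vars eqxx inE.
  have fix_Nb : msym (tperm (var (~~ b) i) (var (~~ b) j)) f = f.
    by apply: msym_tperm_id Df; rewrite in_vars; case: (b).
  by rewrite (diag_tperm_split b) msymMm fix_b fix_Nb.
apply/eqP; rewrite -msupp_eq0; case E: (msupp h) => [//|m r].
have mh : m \in msupp h by rewrite E mem_head.
have [u uf /msupp_hook_Delta[s us]] := msupp_diff_apply mh.
have uNb i : u (var (~~ b) i) = 0%N by apply: (Df u uf); rewrite in_vars; case: (b).
have umE b' i : (u (var b' i) + m (var b' i) = hook_exp b' (s i))%N.
  by rewrite -mnmDE us bimonomE.
(* on these positions the exponents of the other kind are 0, so equal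
   exponents of kind [b] would make two pairs coincide *)
have rigid : {in [pred i | hook_exp (~~ b) (s i) == 0%N],
    (fun i => m (var b i)) =1 (fun i => hook_exp b (s i))}.
  apply: staircase_rigid => [i v _ lt_v|i _|i j].
  - have [j [<- ej]] := hook_exp_surj (ltn_trans lt_v (hook_exp_lt b (s i))).
    by exists (s^-1 j)%g; rewrite ?inE permKV ?ej.
  - by rewrite -umE leq_addl.
  rewrite !inE -!umE !uNb !add0n => /eqP mi /eqP mj mij.
  apply: contraTeq mh => nij; have := congr1 (mcoeff m) (alt i j nij).
  rewrite mcoeff_sym mcoeffN (_ : m#_ = m).
    by move/eqP; rewrite -addr_eq0 -mulr2n mulrn_eq0 /= mcoeff_eq0.
  apply: bimonom_eq => b' l; rewrite mnmE diag_tpermE.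
  have [->|/other_kind->] := eqVneq b' b; first by case: tpermP => // ->; rewrite mij.
  by case: tpermP => // ->; rewrite mi mj.
have u0 : u = 0%MM.
  apply: bimonom_eq => b' i; rewrite mnm0E.
  have [->|/other_kind->//] := eqVneq b' b.
  have [e0|e0] := boolP (hook_exp (~~ b) (s i) == 0%N).
    by apply: (@addIn (m (var b i))); rewrite umE add0n rigid.
  by have := umE b i; have := hook_exp_xor e0; rewrite negbK => ->; case: (u _).
by move: uf; rewrite mcoeff_msupp u0 f0 eqxx.
Qed.

End Delta.

(** * Derivatives of the determinant by a full set of variables *)

Section Faces.
Variables (n k : nat) (hk : (1 <= k <= n)%N) (W : bool -> {set 'I_n}).
Hypothesis card_W : forall b, #|W b|.+1 = arm n k b.
Hypothesis disjoint_W : [disjoint W false & W true].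
Implicit Types (b : bool) (i j l : 'I_n) (m : 'X_{1..n + n}) (s : 'S_n).

Definition indicator : 'X_{1..n + n} := bimonom (fun b i => i \in W b).

(** Up to sign and a nonzero factor, the product of the Vandermonde
    determinants in the variables of [W]. *)
Definition face := diff_apply 'X_[indicator] (hook_Delta n k).

Lemma in_W_other b i : i \in W b -> i \in W (~~ b) = false.
Proof.
by case: b => iW; [rewrite (disjointFl disjoint_W) | rewrite (disjointFr disjoint_W)].
Qed.

(** A term of the determinant that survives has nonzero exponents of each kind
    exactly on [W], for reasons of cardinality. *)
Lemma msupp_face m : m \in msupp face -> exists s, forall b i,
  hook_exp n k b (s i) = ((i \in W b) + m (var b i))%N
  /\ (i \in W b) = (hook_exp n k b (s i) != 0%N).
Proof.
rewrite /face diff_applyX msupp_mderivm => /msupp_hook_Delta[s es]; exists s => b i.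
have E l : hook_exp n k b (s l) = ((l \in W b) + m (var b l))%N.
  have := congr1 (fun m : 'X_{1..n + n} => m (var b l)) es.
  by rewrite mnmDE !bimonomE.
split=> //; suff <- : [set l | hook_exp n k b (s l) != 0%N] = W b by rewrite inE.
apply/esym/eqP; rewrite eqEcard -ltnS card_W card_hook_exp // andbT.
by apply/subsetP => l lW; rewrite inE E lW.
Qed.

Lemma poly_in_face :
  poly_in (vars false (W false) :|: vars true (W true)) face.
Proof.
move=> m /msupp_face[s E] u; case: (varP u) => b i; rewrite inE !in_vars => iW.
have [e1 e2] := E b i; have iWb : i \in W b = false by case: b iW {e1 e2} => /negbTE; rewrite ?orbF.
by move: e2 e1; rewrite iWb => /esym/negbFE/eqP-> /esym/eqP; rewrite add0n => /eqP.
Qed.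

(** The variables of the other kind at positions in [W b] do not occur, so a
    diagonal transposition acts as a transposition of variables of kind [b]
    alone. *)
Lemma face_vandermonde b : vandermonde_like (vars b (W b)) face.
Proof.
split=> [u v|m /msupp_face[s E] v].
  case: (varP u) (varP v) => b1 i [b2 j]; rewrite !in_vars.
  move=> /andP[/eqP<- iW] /andP[/eqP<- jW]; rewrite var_eq eqxx /= => nij.
  have <- : msym (diag_tperm i j) face = - face.
    rewrite msym_diff_apply hook_Delta_alternating // diff_applyNr.
    rewrite msymX diag_tpermV; congr (- diff_apply 'X_[_] _).
    apply: bimonom_eq => b' l; rewrite mnmE diag_tpermE !bimonomE; congr nat_of_bool.
    case: tpermP => // ->; have [->|/other_kind->] := eqVneq b' b; rewrite ?iW ?jW //.
      by rewrite !in_W_other.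
    by rewrite !in_W_other.
  rewrite (diag_tperm_split (~~ b)) negbK msymMm; congr msym; apply/esym.
  by apply: msym_tperm_id poly_in_face; rewrite inE !in_vars;
     case: (b) iW jW => /in_W_other ? /in_W_other /= ?; rewrite ?orbF /=; apply/negbT.
rewrite card_vars => lt_v; have lt_v1 : (v.+1 < arm n k b)%N by rewrite -card_W ltnS.
have [j [ej _]] := hook_exp_surj hk lt_v1.
have [e1 e2] := E b (s^-1 j)%g; rewrite permKV ej in e1 e2.
exists (var b (s^-1 j)%g); first by rewrite in_vars eqxx e2.
by move: e1; rewrite e2 add1n => -[].
Qed.

(** A permutation matching the positions in [W] with the right columns is
    obtained by listing the remaining position first, then [W true], then [W
    false]. *)
Lemma face_neq0 : face != 0.
Proof.
have [s le_s] : exists s, (indicator <= hook_mon k s)%MM.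
  pose C := ~: (W false :|: W true).
  (* [C] consists of one position, which receives column 0 *)
  pose L := enum C ++ enum (W true) ++ enum (W false).
  have Wf := card_W false; have Wt := card_W true; rewrite /= in Wf Wt.
  have cardC : #|C| = 1%N.
    have := cardsC (W false :|: W true); rewrite cardsU card_ord.
    have := disjoint_W; rewrite -setI_eq0 => /eqP->; rewrite cards0 -/C.
    move: Wf Wt hk; move: #|W false| #|W true| #|C| => a d c; lia.
  have mem_L i : i \in L by rewrite !mem_cat !mem_enum !inE; do 2![case: (_ \in _)].
  have szL : size L = n.
    rewrite !size_cat -!cardE cardC; move: Wf Wt hk; move: #|W false| #|W true| => a d; lia.
  have ltL i : (index i L < n)%N by rewrite -[X in (_ < X)%N]szL index_mem.
  have injL : injective (fun i => Ordinal (ltL i)).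
    by move=> i j [eij]; rewrite -(nth_index i (mem_L i)) eij nth_index.
  exists (perm injL); apply/mnm_lepP => u; case: (varP u) => b i; rewrite !bimonomE permE /=.
  case: (boolP (i \in W b)) => // iW; rewrite lt0n /L !index_cat -!cardE cardC.
  have iC : i \in enum C = false.
    by rewrite mem_enum !inE; case: b iW => ->; rewrite ?orbT.
  rewrite iC; case: b iW => iW; rewrite mem_enum ?iW ?(in_W_other iW).
    have : (index i (enum (W true)) < #|W true|)%N by rewrite cardE index_mem mem_enum.
    move: Wt; rewrite /=; move: #|W true| (index _ _) => a x; move=> Wt; case: (leqP (1 + x)%N) => ?; lia.
  rewrite /=.
  by move: Wt; move: #|W true| (index _ _) => a x; lia.
have : hook_mon k s \in msupp (hook_Delta n k) := hook_mon_msupp hk s.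
rewrite -(submK le_s) addmC -msupp_mderivm -diff_applyX -/face.
by apply: contraTneq => ->; rewrite msupp0.
Qed.

End Faces.

(** * Words in lexicographic order *)

Section Ternary.
Local Open Scope nat_scope.

(** Base 3 numerals turn lexicographic comparison into comparison of natural
    numbers, which makes induction on words immediate. *)
Fixpoint ternary (a : nat -> nat) (n : nat) : nat :=
  if n is m.+1 then 3 * ternary a m + a m else 0.

Variables a b : nat -> nat.
Hypotheses (a3 : forall j, a j < 3) (b3 : forall j, b j < 3).

Lemma ternary_inj n : ternary a n = ternary b n -> forall j, j < n -> a j = b j.
Proof.
elim: n => // n IHn /= eq_ab; have := a3 n; have := b3 n => bn an.
have [/IHn eq_lt eqn] : ternary a n = ternary b n /\ a n = b n by lia.
by move=> j; rewrite ltnS leq_eqVlt => /orP[/eqP->|/eq_lt].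
Qed.

Lemma ternary_ltP n : ternary a n < ternary b n ->
  exists i, [/\ i < n, forall j, j < i -> a j = b j & a i < b i].
Proof.
elim: n => // n IHn /= lt_ab; have := a3 n; have := b3 n => bn an.
have [lt_n|ge_n] := ltnP (ternary a n) (ternary b n).
  by have [i [lt_in eq_lt lt_i]] := IHn lt_n; exists i; split=> //; apply: leqW.
by exists n; split=> //; [apply: ternary_inj; lia | lia].
Qed.

Lemma ternary_lt n i : i < n -> (forall j, j < i -> a j = b j) -> a i < b i ->
  ternary a n < ternary b n.
Proof.
move=> lt_in eq_lt lt_i; elim: n lt_in => // n IHn.
rewrite ltnS leq_eqVlt => /orP[/eqP<-|/IHn] /=; last by have := a3 n; have := b3 n; lia.
suff -> : ternary a i = ternary b i by rewrite ltn_add2l.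
elim: i eq_lt {lt_i IHn} => //= i IHi eq_lt; rewrite eq_lt // IHi // => j /leqW.
exact: eq_lt.
Qed.

End Ternary.

Section Words.
Variables (n k : nat) (hk : (1 <= k <= n)%N).
Implicit Types (b : bool) (c i j l : 'I_n) (A : {set 'I_n}) (m : 'X_{1..n + n}).

Definition word c A := A \subset [set~ c] /\ #|A| = (k - 1)%N.

Definition word_set c A b := if b then hook_compl A c else A.

(** The values encode x < c < y, the order for which both straightening and
    independence are triangular. *)
Definition letter c A (j : nat) : nat :=
  if j \in [seq val i | i <- enum A] then 0%N else if j == c then 1%N else 2.

Definition code c A := ternary (letter c A) n.

Lemma letterE c A i :
  letter c A i = if i \in A then 0%N else if i == c then 1%N else 2.
Proof. by rewrite /letter (mem_map val_inj) mem_enum. Qed.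

Lemma letter_lt3 c A (j : nat) : (letter c A j < 3)%N.
Proof. by rewrite /letter; case: ifP => // _; case: ifP. Qed.

Lemma wordN c A : word c A -> c \in A = false.
Proof. by move=> [/subsetP sA _]; apply/negP => /sA; rewrite !inE eqxx. Qed.

Lemma in_hook_compl c A i : (i \in hook_compl A c) = (i != c) && (i \notin A).
Proof. by rewrite in_setC in_setU1 negb_or. Qed.

Lemma card_word_set c A b : word c A -> #|word_set c A b|.+1 = arm n k b.
Proof.
move=> wA; have := wA.2; case: b => /= cardA; last by move: hk; lia.
have := cardsC (c |: A); rewrite cardsU1 (wordN wA) card_ord cardA -/(hook_compl A c).
by move: hk; move: #|hook_compl A c| => x; lia.
Qed.

Lemma disjoint_word_set c A : [disjoint word_set c A false & word_set c A true].
Proof.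
by rewrite disjoints_subset; apply/subsetP => i iA; rewrite !inE iA orbT.
Qed.

Lemma word_letter_inj c A c' A' : word c A ->
  (forall i, letter c A i = letter c' A' i) -> c = c' /\ A = A'.
Proof.
move=> wA eql; have eqA : A = A'.
  apply/setP => i; have := eql i; rewrite !letterE.
  by do 2!case: (_ \in _) => //; case: eqP.
split=> //; have := eql c; rewrite !letterE -eqA (wordN wA) eqxx.
by case: eqP.
Qed.

Lemma code_inj c A c' A' : word c A -> code c A = code c' A' -> c = c' /\ A = A'.
Proof.
move=> wA /ternary_inj eql; apply: word_letter_inj => // i.
by apply: eql => // j; apply: letter_lt3.
Qed.

Lemma code_ltP c A c' A' : (code c A < code c' A')%N -> exists i,
  (forall j, (j < i)%N -> letter c A j = letter c' A' j) /\
  (letter c A i < letter c' A' i)%N.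
Proof.
case/ternary_ltP=> [j|j|i [lt_in eq_lt lt_i]]; try exact: letter_lt3.
by exists (Ordinal lt_in); split=> // j; apply: eq_lt.
Qed.

Lemma code_lt c A c' A' i :
  (forall j, (j < i)%N -> letter c A j = letter c' A' j) ->
  (letter c A i < letter c' A' i)%N -> (code c A < code c' A')%N.
Proof.
move=> eq_lt lt_i; apply: (@ternary_lt _ _ _ _ _ i) => // [j|j|j lt_j].
- exact: letter_lt3.
- exact: letter_lt3.
- exact: (eq_lt (Ordinal (ltn_trans lt_j (ltn_ord i)))).
Qed.

Definition crossing c A := bimonom (fun b i =>
  (i \in word_set c A b) && (if b then i < c else c < i)%N).

Definition cocrossing c A := bimonom (fun b i =>
  (i \in word_set c A b) && (if b then c < i else i < c)%N).

Lemma hook_monomialE c A : hook_monomial A c = 'X_[crossing c A].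
Proof.
rewrite /hook_monomial !mprodXE -mpolyXD; congr 'X_[_].
have sumU b (P : pred 'I_n) b' i :
    (\sum_(j | P j) U_(var b j))%MM (var b' i) = (b == b') && P i.
  rewrite mnm_sumE (eq_bigr (fun j => ((b == b') && (j == i) : nat))); last first.
    by move=> j _; rewrite mnm1E var_eq.
  case: (b == b') => /=; last by rewrite big1.
  case Pi: (P i); first by rewrite (bigD1 i) //= eqxx big1 // => j /andP[_ /negbTE->].
  by rewrite big1 // => j Pj; case: eqP => // eji; rewrite -eji Pj in Pi.
apply: bimonom_eq => b i; rewrite mnmDE bimonomE.
rewrite (sumU false (fun i => (i \in A) && (c < i)%N)).
rewrite (sumU true (fun i => (i \in hook_compl A c) && (i < c)%N)).
by case: b; rewrite /= ?addn0.
Qed.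

Lemma crossingD c A : word c A ->
  (cocrossing c A + crossing c A)%MM = indicator (word_set c A).
Proof.
move=> wA; apply: bimonom_eq => b i; rewrite mnmDE !bimonomE.
case: (boolP (i \in word_set c A b)) => //= iW.
have : i != c :> nat.
  apply: contraTneq iW => /val_inj ->.
  by case: b; rewrite /= ?in_hook_compl ?eqxx ?(wordN wA).
by case: b {iW}; case: (ltngtP i c).
Qed.

(** Compare the words at their first difference [i]. If the letters are x and
    c, all x of the second word together with [x_i] divide the product; if
    they are c and y, all y of the first word together with [y_i] do. If they
    are x and y, some position carries both x and y: either [i] itself, when
    both letters c come later, or, when c has already occurred, a later
    position, because the words contain equally many x. *)
Lemma kills_cocrossing c A c' A' : word c A -> word c' A' ->
  (code c A < code c' A')%N ->
  diff_apply 'X_[cocrossing c A + crossing c' A'] (hook_Delta n k) = 0.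
Proof.
move=> wA wA' /code_ltP[i [eq_lt lt_i]]; set m := (_ + _)%MM.
have mE b l : m (var b l) =
    ((l \in word_set c A b) && (if b then c < l else l < c) +
     (l \in word_set c' A' b) && (if b then l < c' else c' < l))%N.
  by rewrite mnmDE !bimonomE.
have eqA l : (l < i)%N -> (l \in A) = (l \in A').
  by move/eq_lt; rewrite !letterE; do 2!case: (_ \in _) => //; case: eqP.
have eqc l : (l < i)%N -> (l == c) = (l == c').
  move=> lt_l; have := eq_lt l lt_l; rewrite !letterE -(eqA l lt_l).
  have [lA _|_] := boolP (l \in A); last by do 2!case: (l == _).
  have lA' : l \in A' by rewrite -eqA.
  have [elc|_] := eqVneq l c; first by rewrite elc wordN in lA.
  by have [elc'|//] := eqVneq l c'; rewrite elc' wordN in lA'.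
have ltc : (c < i)%N -> c' = c by move/eqc; rewrite eqxx => /esym/eqP.
have ltc' : (c' < i)%N -> c' = c by move/eqc; rewrite eqxx => /eqP.
move: lt_i; rewrite !letterE; have [iA|iA] := boolP (i \in A).
  have nic : i != c by apply: contraTneq iA => ->; rewrite (wordN wA).
  case: (boolP (i \in A')) => // iA' _; have [eic'|nic'] := eqVneq i c'.
    have lt_ic : (i < c)%N.
      case: (ltngtP i c) => // [/ltc cc|/val_inj eic]; last by rewrite eic eqxx in nic.
      by rewrite eic' cc eqxx in nic.
    apply: (@kills_many _ _ hk m false (i |: A')).
      by rewrite cardsU1 iA' wA'.2 /=; move: hk; lia.
    move=> l; rewrite mE !inE /= -eic' => /orP[/eqP->|lA']; first by rewrite iA lt_ic.
    case: (ltngtP l i) => [lt_l|lt_l|/val_inj eli].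
    - by rewrite eqA // lA' (ltn_trans lt_l lt_ic).
    - by rewrite lA' addnC.
    - by rewrite -eli lA' in iA'.
  have iB' : i \in hook_compl A' c' by rewrite in_hook_compl nic'.
  have [lt_ic|] := ltnP i c.
    have lt_ic' : (i < c')%N.
      case: (ltngtP i c') => // [lt_c'i|/val_inj eic]; last by rewrite eic eqxx in nic'.
      by have := ltn_trans lt_c'i lt_ic; rewrite (ltc' lt_c'i) ltnn.
    by apply: (@kills_xy _ _ hk m i); rewrite mE /= ?iA ?lt_ic ?iB' ?lt_ic' // addnC.
  rewrite leq_eqVlt => /orP[/eqP/val_inj eci|lt_ci]; first by rewrite eci eqxx in nic.
  have cc := ltc lt_ci.
  have [l lA' lA] : exists2 l, l \in A' & l \notin A.
    apply/subsetPn; apply: contra iA' => sA'.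
    suff -> : A' = A by [].
    by apply/eqP; rewrite eqEcard sA' wA.2 wA'.2 leqnn.
  have lt_il : (i < l)%N.
    case: (ltngtP i l) => // [/eqA eqAl|/val_inj eil]; first by rewrite eqAl lA' in lA.
    by rewrite eil lA' in iA'.
  have lt_cl := ltn_trans lt_ci lt_il.
  have nlc : l != c by apply: contraTneq lt_cl => ->; rewrite ltnn.
  apply: (@kills_xy _ _ hk m l); rewrite mE /= ?lA' ?cc ?lt_cl ?in_hook_compl ?nlc ?lA //.
  by rewrite addnC.
have [eic|nic] := eqVneq i c; last by case: ifP => //; case: ifP.
case: ifP => // /negbT iA'; case: eqP => // /eqP nic' _.
have lt_ic' : (i < c')%N.
  case: (ltngtP i c') => // [/ltc' cc|/val_inj eic']; last by rewrite eic' eqxx in nic'.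
  by rewrite cc -eic eqxx in nic'.
apply: (@kills_many _ _ hk m true (i |: hook_compl A c)).
  rewrite cardsU1 in_hook_compl eic eqxx /= add1n.
  by rewrite (card_word_set true wA).
move=> l; rewrite mE in_setU1 /= => /orP[/eqP->|lB].
  by rewrite addnC (in_hook_compl c') nic' iA' lt_ic'.
have [nlc lA] : l != c /\ l \notin A by apply/andP; rewrite -in_hook_compl.
case: (ltngtP l i) => [lt_l|lt_l|/val_inj eli].
- rewrite addnC (in_hook_compl c') -(eqA l lt_l) lA -(eqc l lt_l) nlc.
  by rewrite (ltn_trans lt_l lt_ic').
- by rewrite lB -eic lt_l.
- by rewrite eli eic eqxx in nlc.
Qed.

End Words.

(** * Straightening *)

Section Straighten.
Variables (n k : nat) (hk : (1 <= k <= n)%N).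
Implicit Types (b : bool) (c i j l : 'I_n) (A : {set 'I_n}) (m : 'X_{1..n + n}).

(** If [i < c], then [y_i] divides the monomial. Otherwise let [d] be the last
    x before c. Replacing the letter at [d] by c and the one at [i] by x (and
    the old c, unless it is at [i], by y) gives a larger word; the y from [d]
    on drop out of its monomial, which therefore divides the product. If there
    is no such [d], all [k - 1] x of the word and [x_i] occur in the product. *)
Lemma straighten_x c A i : word k c A -> i \notin A ->
  diff_apply 'X_[U_(var false i) + crossing c A] (hook_Delta n k) = 0 \/
  exists c' A', [/\ word k c' A', (code c A < code c' A')%N
    & (crossing c' A' <= U_(var false i) + crossing c A)%MM].
Proof.
move=> wA iA; have nAc := wordN wA; set m := (_ + _)%MM.
have mE b l : m (var b l) = ((b == false) && (i == l) +
    ((l \in word_set c A b) && (if b then l < c else c < l)))%N.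
  by rewrite mnmDE mnm1E var_eq eq_sym bimonomE.
have [lt_ic|le_ci] := ltnP i c.
  left; apply: (@kills_xy _ _ hk m i); rewrite mE ?eqxx //=.
  have nic : i != c by apply: contraTneq lt_ic => ->; rewrite ltnn.
  by rewrite in_hook_compl iA lt_ic nic.
(* [d] below is the largest position counted by this predicate *)
case: (pickP [pred l | (l \in A) && (l < c)%N]) => [l0 Pl0|noA]; last first.
  left; apply: (@kills_many _ _ hk m false (i |: A)).
    by rewrite cardsU1 iA wA.2 /=; move: hk; lia.
  move=> l; rewrite mE !inE eq_sym /= => /orP[->//|lA].
  have := noA l; rewrite /= lA /= => /negbT; rewrite -leqNgt leq_eqVlt.
  by case/orP=> [/eqP/val_inj ecl|->]; [rewrite -ecl nAc in lA | rewrite addnC].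
right; case: (@arg_maxnP _ l0 _ (fun l : 'I_n => l : nat) Pl0) => d /andP[dA lt_dc] maxd.
have ndi : i != d by apply: contraTneq dA => <-.
exists d, ((i |: A) :\ d); split.
- split; first by apply/subsetP => l; rewrite !inE => /andP[].
  have := cardsU1 i A; rewrite iA wA.2 add1n.
  by rewrite [X in X = _ -> _](cardsD1 d) !inE dA orbT add1n => -[].
- apply: (@code_lt _ _ _ _ _ d) => [l lt_ld|]; rewrite !letterE !inE ?eqxx ?dA //=.
  have lt_lc := ltn_trans lt_ld lt_dc.
  have -> : l == d = false by apply/eqP => eld; rewrite eld ltnn in lt_ld.
  have -> : l == c = false by apply/eqP => elc; rewrite elc ltnn in lt_lc.
  have -> : l == i = false by apply/eqP => eli; rewrite eli ltnNge le_ci in lt_lc.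
  by [].
- apply/mnm_lepP => u; case: (varP u) => b l; rewrite mE bimonomE.
  case: b => /=; last first.
    rewrite !inE; case: (eqVneq l i) => [->|nli]; first by case: (_ && _).
    rewrite /=; case: (boolP (l \in A)) => lA; last by rewrite andbF.
    rewrite andbT; case: (boolP (d < l)%N) => [lt_dl|]; last by rewrite andbF.
    case: (ltngtP c l) => [|lt_lc|/val_inj ecl]; rewrite ?andbF ?leq_b1 //.
      by have := maxd l; rewrite /= lA lt_lc leqNgt lt_dl => /(_ isT).
    by rewrite -ecl nAc in lA.
  rewrite !in_hook_compl !inE; case: (boolP (l < d)%N) => [lt_ld|]; last by rewrite andbF.
  have lt_lc := ltn_trans lt_ld lt_dc.
  have -> : l == d = false by apply/eqP => eld; rewrite eld ltnn in lt_ld.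
  have -> : l == c = false by apply/eqP => elc; rewrite elc ltnn in lt_lc.
  rewrite lt_lc !andbT.
  by rewrite /= negb_or; case: (_ \in A); rewrite ?andbF //; case: (_ == _).
Qed.

(** Mirror image of the previous lemma, with [d] the first y after c; the new
    word has c at [d], y at [i], and x at the old c unless it is at [i]. It is
    larger because x or c becomes y at [i]. *)
Lemma straighten_y c A i : word k c A -> i \notin hook_compl A c ->
  diff_apply 'X_[U_(var true i) + crossing c A] (hook_Delta n k) = 0 \/
  exists c' A', [/\ word k c' A', (code c A < code c' A')%N
    & (crossing c' A' <= U_(var true i) + crossing c A)%MM].
Proof.
move=> wA iB; have nAc := wordN wA; set m := (_ + _)%MM.
have mE b l : m (var b l) = ((b == true) && (i == l) +
    ((l \in word_set c A b) && (if b then l < c else c < l)))%N.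
  by rewrite mnmDE mnm1E var_eq eq_sym bimonomE.
have icA : i \in c |: A by rewrite inE negbK in iB.
have [lt_ci|le_ic] := ltnP c i.
  left; apply: (@kills_xy _ _ hk m i); rewrite mE ?eqxx //= lt_ci andbT.
  by move: icA; rewrite !inE => /orP[/eqP eic|->//]; rewrite eic ltnn in lt_ci.
(* [d] below is the smallest position counted by this predicate *)
case: (pickP [pred l | (l \in hook_compl A c) && (c < l)%N]) => [l0 Pl0|noB]; last first.
  left; apply: (@kills_many _ _ hk m true (i |: hook_compl A c)).
    by rewrite cardsU1 iB add1n (card_word_set hk true wA).
  move=> l; rewrite mE in_setU1 eq_sym /= => /orP[->//|lB].
  have := noB l; rewrite /= lB /= => /negbT; rewrite -leqNgt leq_eqVlt.
  case/orP=> [/eqP/val_inj elc|->]; last by rewrite addnC.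
  by rewrite elc in_hook_compl eqxx in lB.
right; case: (@arg_minnP _ l0 _ (fun l : 'I_n => l : nat) Pl0) => d /andP[dB lt_cd] mind.
have [ndc dA] : d != c /\ d \notin A by apply/andP; rewrite -in_hook_compl.
have lt_id := leq_ltn_trans le_ic lt_cd.
exists d, ((c |: A) :\ i); split.
- split.
    apply/subsetP => l; rewrite !inE => /andP[_ /orP[/eqP->|lA]]; first by rewrite eq_sym.
    by apply: contraTneq lA => ->.
  have := cardsU1 c A; rewrite nAc wA.2 add1n.
  by rewrite [X in X = _ -> _](cardsD1 i) icA add1n => -[].
- apply: (@code_lt _ _ _ _ _ i) => [l lt_li|].
    have lt_lc := leq_trans lt_li le_ic; have lt_ld := ltn_trans lt_li lt_id.
    rewrite !letterE !inE.
    have -> : l == d = false by apply/eqP => eld; rewrite eld ltnn in lt_ld.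
    have -> : l == c = false by apply/eqP => elc; rewrite elc ltnn in lt_lc.
    have -> : l == i = false by apply/eqP => eli; rewrite eli ltnn in lt_li.
    by [].
  rewrite !letterE !inE eqxx /=.
  have -> : i == d = false by apply/eqP => eid; rewrite eid ltnn in lt_id.
  by move: icA; rewrite !inE; case: (_ \in A) => //; rewrite orbF => ->.
- apply/mnm_lepP => u; case: (varP u) => b l; rewrite mE bimonomE.
  case: b => /=; last first.
    rewrite !inE; case: (boolP (d < l)%N) => [lt_dl|]; last by rewrite andbF.
    have lt_cl := ltn_trans lt_cd lt_dl; rewrite lt_cl !andbT.
    have -> : l == c = false by apply/eqP => elc; rewrite elc ltnn in lt_cl.
    by case: (_ \in A); rewrite ?andbF ?leq_b1.
  rewrite [in X in (X <= _)%N]in_hook_compl !inE.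
  case: (boolP (l < d)%N) => [lt_ld|]; last by rewrite andbF.
  case: (eqVneq i l) => [_|_] /=; first by case: (_ && _).
  case: (boolP ((l == c) || (l \in A))) => [_|]; first by rewrite andbF.
  rewrite negb_or -in_hook_compl => lB; suff -> : (l < c)%N by case: (_ && _).
  case: (ltngtP c l) => [lt_cl|//|/val_inj ecl]; last by rewrite -ecl in_hook_compl eqxx in lB.
  by have := mind l; rewrite /= lB lt_cl leqNgt lt_ld => /(_ isT).
Qed.

Lemma straighten b c A i : word k c A -> i \notin word_set c A b ->
  diff_apply 'X_[U_(var b i) + crossing c A] (hook_Delta n k) = 0 \/
  exists c' A', [/\ word k c' A', (code c A < code c' A')%N
    & (crossing c' A' <= U_(var b i) + crossing c A)%MM].
Proof. by case: b; [apply: straighten_y | apply: straighten_x]. Qed.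

(** The smallest word x...xcy...y, in which no x comes after c and no y before
    it. *)
Lemma initial_word : exists c A, word k c A /\ crossing c A = 0%MM.
Proof.
have lt_kn : (k.-1 < n)%N by move: hk; lia.
pose c := Ordinal lt_kn; exists c, [set i : 'I_n | (i < c)%N]; split.
  split; first by apply/subsetP => i; rewrite !inE; apply: contraTneq => ->; rewrite ltnn.
  have -> : [set i : 'I_n | (i < c)%N] = [set widen_ord (ltnW lt_kn) j | j : 'I_(k.-1)].
    apply/setP => i; rewrite !inE; apply/idP/imsetP => [lt_i|[j _ ->]]; last exact: ltn_ord j.
    by exists (Ordinal (lt_i : (i < k.-1)%N)) => //; apply: val_inj.
  rewrite card_imset ?card_ord ?subn1 // => i j /(congr1 val) /= eij.
  exact: val_inj.
apply: bimonom_eq => b i; rewrite bimonomE mnm0E.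
case: b; rewrite /= ?in_hook_compl !inE; case: (ltngtP i c) => //=; rewrite ?andbF //.
Qed.

End Straighten.

(** * The basis theorem *)

Lemma lin_spanD (R : fieldType) (V : lmodType R) (S : V -> Prop) u v :
  lin_span S u -> lin_span S v -> lin_span S (u + v).
Proof.
move=> [s [sS ->]] [t [tS ->]]; exists (s ++ t); split; last by rewrite big_cat.
by move=> x; rewrite mem_cat => /orP[/sS|/tS].
Qed.

Lemma lin_span0 (R : fieldType) (V : lmodType R) (S : V -> Prop) : lin_span S 0.
Proof. by exists [::]; rewrite big_nil. Qed.

Section Basis.
Variables (n k : nat) (hk : (1 <= k <= n)%N).
Variable B : bool -> 'I_n -> {set 'I_n} -> {mpoly rat[n + n]} -> Prop.
Hypothesis basisB : forall b c A, word k c A ->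
  coinvariant_basis (vars b (word_set c A b)) (B b c A).
Implicit Types (b : bool) (c i j l : 'I_n) (A : {set 'I_n}) (m : 'X_{1..n + n}).
Implicit Types (f g h p q : {mpoly rat[n + n]}).

Local Notation Delta := (hook_Delta n k).

Definition basis_product p := exists c A f g,
  [/\ word k c A, B false c A f, B true c A g & p = 'X_[crossing c A] * f * g].

Definition spanned h := exists p, lin_span basis_product p /\ diff_apply (h - p) Delta = 0.

Lemma spannedD h h' : spanned h -> spanned h' -> spanned (h + h').
Proof.
move=> [p [pS hp]] [q [qS hq]]; exists (p + q); split; first exact: lin_spanD.
by rewrite opprD addrACA diff_applyDl hp hq addr0.
Qed.

Lemma spanned_kills h : diff_apply h Delta = 0 -> spanned h.
Proof. by move=> h0; exists 0; split; [apply: lin_span0 | rewrite subr0]. Qed.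

Lemma spannedZ a h : spanned h -> spanned (a *: h).
Proof.
move=> [p [[s [sS pE]] hp]]; exists (a *: p); split; last first.
  by rewrite -scalerBr diff_applyZl hp scaler0.
exists [seq (a * t.1, t.2) | t <- s]; split; first by move=> _ /mapP[t /sS ? ->].
by rewrite big_map pE scaler_sumr; apply: eq_bigr => t _; rewrite scalerA.
Qed.

Lemma spanned_sum (I : eqType) (r : seq I) (F : I -> {mpoly rat[n + n]}) :
  (forall x, x \in r -> spanned (F x)) -> spanned (\sum_(x <- r) F x).
Proof.
move=> rF; rewrite big_seq; elim/big_ind: _ => // [|h h'].
  by apply: spanned_kills; apply: diff_apply0l.
exact: spannedD.
Qed.

Lemma spanned_mem p : basis_product p -> spanned p.
Proof.
move=> pS; exists p; split; last by rewrite subrr diff_apply0l.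
exists [:: (1, p)]; rewrite big_seq1 scale1r; split=> // t.
by rewrite inE => /eqP->.
Qed.

Lemma kills_mulr f g : diff_apply f Delta = 0 -> diff_apply (f * g) Delta = 0.
Proof. by move=> f0; rewrite mulrC diff_applyM f0 diff_applyr0. Qed.

Lemma spanned_monomials p : (forall m, spanned (p * 'X_[m])) -> forall h, spanned (p * h).
Proof.
move=> pX h; rewrite {1}[h]mpolyE mulr_sumr; apply: spanned_sum => m _.
by rewrite -scalerAr; apply: spannedZ.
Qed.

Section Step.
Variables (c : 'I_n) (A : {set 'I_n}) (wA : word k c A).
Hypothesis IH : forall c' A', word k c' A' -> (code c A < code c' A')%N ->
  forall h, spanned ('X_[crossing c' A'] * h).

Lemma step_var b i h : i \notin word_set c A b ->
  spanned ('X_[crossing c A] * ('X_(var b i) * h)).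
Proof.
move=> iW; rewrite mulrA -mpolyXD addmC.
have [kill|[c' [A' [wA' lt_code le_m]]]] := straighten hk wA iW.
  by apply/spanned_kills/kills_mulr.
by rewrite -(submK le_m) addmC mpolyXD -mulrA; apply: IH.
Qed.

Lemma step_monomial b i m h : i \notin word_set c A b -> m (var b i) != 0%N ->
  spanned ('X_[crossing c A] * ('X_[m] * h)).
Proof.
move=> iW mi; have le_m : (U_(var b i) <= m)%MM by rewrite lep1mP.
by rewrite -(submK le_m) addmC mpolyXD -mulrA; apply: step_var iW.
Qed.

(** Replace the symmetric polynomial by a lift to all variables of its kind,
    which annihilates the determinant; the difference involves variables
    outside the word. *)
Lemma step_symmetric b f h : symmetric_pos (vars b (word_set c A b)) f ->
  spanned ('X_[crossing c A] * (f * h)).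
Proof.
move=> symf; have sWT : vars b (word_set c A b) \subset vars b setT.
  by apply/subsetP => u; case: (varP u) => b' i; rewrite !in_vars inE => /andP[->].
have [t symt tf] := symmetric_pos_lift sWT symf.
rewrite -[f](subrK t) mulrDl mulrDr; apply: spannedD; last first.
  rewrite mulrCA; apply/spanned_kills/kills_mulr.
  exact: (kills_symmetric hk symt).
rewrite [f - t]mpolyE mulr_suml mulr_sumr; apply: spanned_sum => m /tf[u].
case: (varP u) => b' i; rewrite !inE !in_vars => /andP[iW /andP[/eqP eb _]] mi.
rewrite -scalerAl -scalerAr; apply: spannedZ; apply: step_monomial mi.
by rewrite -eb eqxx in iW *.
Qed.

Lemma step_ideal b p h : coinvariant_ideal (vars b (word_set c A b)) p ->
  spanned ('X_[crossing c A] * (p * h)).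
Proof.
move=> [s [sD ->]]; rewrite mulr_suml mulr_sumr; apply: spanned_sum => t /sD[_ symt].
by rewrite -mulrA [t.1 * _]mulrCA; apply: step_symmetric symt.
Qed.

Lemma step_basis f g : lin_span (B false c A) f -> lin_span (B true c A) g ->
  spanned ('X_[crossing c A] * (f * g)).
Proof.
move=> [s [sB ->]] [t [tB ->]]; rewrite mulr_suml mulr_sumr.
apply: spanned_sum => u us; rewrite -scalerAl -scalerAr; apply: spannedZ.
rewrite !mulr_sumr; apply: spanned_sum => v vt; rewrite -!scalerAr.
apply/spannedZ/spanned_mem; exists c, A, u.2, v.2; split=> //; rewrite ?mulrA //.
- exact: sB.
- exact: tB.
Qed.

(** Monomials involving a variable outside the word move to larger words. The
    others factor into an x-part and a y-part, which are expanded in the two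
    bases modulo the coinvariant ideals. *)
Lemma step h : spanned ('X_[crossing c A] * h).
Proof.
apply: spanned_monomials => m.
case: (pickP (fun bi : bool * 'I_n => (bi.2 \notin word_set c A bi.1) && (m (var bi.1 bi.2) != 0%N))).
  by move=> [b i] /andP[iW mi]; rewrite -['X_[m]]mulr1; apply: step_monomial iW mi.
move=> noW; pose part b := bimonom (fun b' i => if b == b' then m (var b' i) else 0%N).
have -> : m = (part false + part true)%MM.
  by apply: bimonom_eq => b i; rewrite mnmDE !bimonomE; case: b; rewrite /= ?addn0.
have in_part b : poly_in (vars b (word_set c A b)) ('X_[part b] : {mpoly rat[n + n]}).
  apply: poly_inX => u; case: (varP u) => b' i; rewrite in_vars bimonomE.
  case: eqP => //= <- iW; apply/eqP/negbFE.
  by have := noW (b, i); rewrite /= iW.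
have [_ _ /(_ _ (in_part false))[f [fB ff]]] := basisB false wA.
have [_ _ /(_ _ (in_part true))[g [gB gg]]] := basisB true wA.
rewrite mpolyXD -['X_[part false]](subrK f) mulrDl mulrDr; apply: spannedD.
  exact: step_ideal ff.
rewrite -['X_[part true]](subrK g) mulrDr mulrDr; apply: spannedD.
  by rewrite [f * _]mulrC; apply: step_ideal gg.
exact: step_basis.
Qed.

End Step.

Lemma spanned_all h : spanned h.
Proof.
have [c0 [A0 [w0 m0]]] := initial_word hk.
rewrite -[h]mul1r -mpolyX0 -m0; move: w0 {m0} h.
have code_bound c A : (code c A < 3 ^ n)%N.
  rewrite /code; elim: n (letter c A) (@letter_lt3 _ c A) => // r IHr a a3 /=.
  by have := IHr a a3; have := a3 r; rewrite expnS; lia.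
move: {2}(3 ^ n - code c0 A0)%N (leqnn (3 ^ n - code c0 A0)) => d.
elim: d c0 A0 => [|d IHd] c A le_d wA h.
  by have := code_bound c A; move: le_d; rewrite leqn0 subn_eq0 ltnNge => ->.
apply: (step wA) => c' A' wA' lt_code h'; apply: IHd => //.
by have := code_bound c' A'; move: le_d lt_code; lia.
Qed.

(** Strong induction on the word [w] of a product: after multiplication by
    [n_w], the products of smaller words drop out because their coefficients
    vanish, those of larger words because they are annihilated. *)
Lemma products_independent (s : seq {mpoly rat[n + n]}) (a : {mpoly rat[n + n]} -> rat) :
  uniq s -> (forall v, v \in s -> basis_product v) ->
  diff_apply (\sum_(v <- s) a v *: v) Delta = 0 -> forall v, v \in s -> a v = 0.
Proof.
move=> us sS sum0.
have [c0 [A0 _]] := initial_word hk.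
pose data := ('I_n * {set 'I_n} * ({mpoly rat[n + n]} * {mpoly rat[n + n]}))%type.
pose dec (t : data) v := [/\ word k t.1.1 t.1.2, B false t.1.1 t.1.2 t.2.1,
  B true t.1.1 t.1.2 t.2.2 & v = 'X_[crossing t.1.1 t.1.2] * (t.2.1 * t.2.2)].
(* choose for each product a word and a pair of basis elements *)
pose T v : data := epsilon (inhabits ((c0, A0), (0, 0))) (fun t => dec t v).
have TP v : v \in s -> dec (T v) v.
  move=> /sS vS; apply: (epsilon_spec _ (fun t => dec t v)).
  case: vS => c [A [f [g [wA fB gB ->]]]].
  by exists ((c, A), (f, g)); split; rewrite // mulrA.
pose cd v := code (T v).1.1 (T v).1.2.
suff main r v : cd v = r -> v \in s -> a v = 0 by move=> v; apply: main.
elim/ltn_ind: r v => r IHr v0 cd0 v0s.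
have [wA _ _ _] := TP v0 v0s; set c := (T v0).1.1 in wA; set A := (T v0).1.2 in wA.
pose s' := [seq v <- s | cd v == r].
have same v : v \in s' -> (T v).1 = (c, A).
  rewrite mem_filter => /andP[/eqP cdv vs]; have [wv _ _ _] := TP v vs.
  have [] : (T v).1.1 = c /\ (T v).1.2 = A by apply: code_inj wv _; rewrite -/(cd v) cdv -cd0.
  by case: (T v).1 => ? ? /= -> ->.
have sub_s' v : v \in s' -> v \in s by rewrite mem_filter => /andP[].
pose W := word_set c A.
pose pairs := [seq (T v).2 | v <- s'].
have pairE v : v \in s' -> v = 'X_[crossing c A] * ((T v).2.1 * (T v).2.2).
  by move=> vs'; have [_ _ _] := TP v (sub_s' v vs'); rewrite (same v vs').
have uniq_pairs : uniq pairs.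
  rewrite map_inj_in_uniq ?filter_uniq // => u v us' vs' eT.
  by rewrite (pairE u us') (pairE v vs') eT.
pose a' (t : {mpoly rat[n + n]} * {mpoly rat[n + n]}) := a ('X_[crossing c A] * (t.1 * t.2)).
(* only the products with the word [(c, A)] survive multiplication by
   [cocrossing c A] *)
have vanish : diff_apply (\sum_(t <- pairs) a' t *: (t.1 * t.2)) (face k W) = 0.
  rewrite /face -diff_applyM mulrC -(crossingD wA) mpolyXD -mulrA.
  have -> : 'X_[crossing c A] * (\sum_(t <- pairs) a' t *: (t.1 * t.2)) =
      \sum_(v <- s') a v *: v.
    rewrite big_map mulr_sumr; apply: eq_big_seq => v vs'.
    by rewrite -scalerAr -(pairE v vs') /a' -(pairE v vs').
  have killed := congr1 (diff_apply 'X_[cocrossing c A]) sum0.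
  rewrite diff_applyr0 -diff_applyM in killed; rewrite -[RHS]killed.
  rewrite !mulr_sumr !diff_apply_suml big_filter [RHS](bigID (fun v => cd v == r)) /=.
  rewrite [X in _ = _ + X]big1_seq ?addr0 // => v /andP[ncd vs].
  have [lt_cd|] := ltnP (cd v) r.
    by rewrite (IHr _ lt_cd v) // scale0r mulr0 diff_apply0l.
  rewrite leq_eqVlt eq_sym (negbTE ncd) /= -cd0 => lt_cd.
  have [wv _ _ vE] := TP v vs; rewrite -scalerAr diff_applyZl.
  rewrite [X in diff_apply (_ * X)]vE (mulrA 'X_[cocrossing c A]) -mpolyXD.
  by rewrite kills_mulr ?scaler0 // kills_cocrossing.
have dW : [disjoint vars false (W false) & vars true (W true)].
  rewrite -setI_eq0; apply/eqP/setP => u; case: (varP u) => b i.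
  by rewrite in_setI in_set0 !in_vars; case: b; rewrite /= ?andbF.
have cW b := card_word_set hk b wA.
have dWW := disjoint_word_set c A.
have [inB1 ind1 _] := basisB false wA; have [inB2 ind2 _] := basisB true wA.
have pairsB t : t \in pairs -> B false c A t.1 /\ B true c A t.2.
  by case/mapP=> v vs' ->; have [_] := TP v (sub_s' v vs'); rewrite (same v vs').
have v0s' : v0 \in s' by rewrite mem_filter cd0 eqxx.
have := product_independent dW (face_vandermonde hk cW dWW false)
  (face_vandermonde hk cW dWW true) (face_neq0 hk cW dWW) ind1 inB1 ind2 inB2
  uniq_pairs pairsB vanish (map_f _ v0s').
by rewrite /a' -(pairE v0 v0s').
Qed.

End Basis.

Theorem theorem1p5 (n k : nat) (hk : (1 <= k <= n)%N)
    (B C : 'I_n -> {set 'I_n} -> {mpoly rat[n + n]} -> Prop)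
    (hB : forall (c : 'I_n) (A : {set 'I_n}),
        A \subset [set~ c] -> #|A| = (k - 1)%N ->
        coinvariant_basis (xvars A) (B c A))
    (hC : forall (c : 'I_n) (A : {set 'I_n}),
        A \subset [set~ c] -> #|A| = (k - 1)%N ->
        coinvariant_basis (yvars (hook_compl A c)) (C c A)) :
  hook_basis k (fun p => exists (c : 'I_n) (A : {set 'I_n}) (b b' : {mpoly rat[n + n]}),
      [/\ A \subset [set~ c], #|A| = (k - 1)%N, B c A b, C c A b'
        & p = hook_monomial A c * b * b']).
Proof.
pose D (b : bool) := if b then C else B.
have basisD b c A : word k c A -> coinvariant_basis (vars b (word_set c A b)) (D b c A).
  by case=> sA cA; case: b; [apply: hC | apply: hB].
have memE p : (exists (c : 'I_n) (A : {set 'I_n}) (b b' : {mpoly rat[n + n]}),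
      [/\ A \subset [set~ c], #|A| = (k - 1)%N, B c A b, C c A b'
        & p = hook_monomial A c * b * b']) <-> basis_product k D p.
  split=> [[c [A [f [g [sA cA fB gC ->]]]]]|[c [A [f [g [[sA cA] fB gC ->]]]]]];
    by exists c, A, f, g; rewrite hook_monomialE.
split=> // [s a us sS /orthogonal_derivative_spaceP|v _].
  by apply: (products_independent hk basisD) => // v /sS/memE.
have [p [[s [sS pE]] vp]] := spanned_all hk basisD v.
exists p; split; first by exists s; split=> // t /sS/memE.
exact/orthogonal_derivative_spaceP.
Qed.
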